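(* Let $R$ be a ring and let $\mathbb{F}$ be a class of $R$-left-modules (closed under isomorphisms). If $\mathbb{F}$ contains the ground ring $R$ (viewed as an $R$-left-module) and is closed under extensions, set indexed direct sums, pure submodules, and pure quotient modules, then $(\mathbb{F},\mathbb{F}^{\perp})$ is a perfect cotorsion pair. In particular, $\mathbb{F}$ is covering and $\mathbb{F}^{\perp}$ is enveloping.
   Context: $R$ is a ring, and ''class'' means a class of $R$-left-modules closed under isomorphisms. A short exact sequence $0 \to M' \to M \to M'' \to 0$ of $R$-left-modules is pure exact if it stays exact when tensored with any $R$-right-module; then $M'$ is called a pure submodule and $M''$ a pure quotient module of $M$. For classes $\mathbb{F}$, $\mathbb{G}$ of $R$-left-modules put $\mathbb{F}^{\perp} = \{ N \mid \operatorname{Ext}^1_R(F,N) = 0 \text{ for all } F \in \mathbb{F}\}$ and ${}^{\perp}\mathbb{G} = \{ M \mid \operatorname{Ext}^1_R(M,G) = 0 \text{ for all } G \in \mathbb{G}\}$. The pair $(\mathbb{F},\mathbb{G})$ is a cotorsion pair if $\mathbb{F}^{\perp} = \mathbb{G}$ and $\mathbb{F} = {}^{\perp}\mathbb{G}$. It is perfect if $\mathbb{F}$ is covering and $\mathbb{G}$ is enveloping. An $\mathbb{F}$-precover of an $R$-left-module $M$ is a homomorphism $F \to M$ with $F$ in $\mathbb{F}$ such that each homomorphism $F' \to M$ with $F'$ in $\mathbb{F}$ factors as $F' \to F \to M$. An $\mathbb{F}$-cover of $M$ is an $\mathbb{F}$-precover $F \to M$ such that each endomorphism $F \to F$ for which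 the composite $F \to F \to M$ equals $F \to M$ is an automorphism. $\mathbb{F}$ is covering if each $R$-left-module has an $\mathbb{F}$-cover. Dually, a $\mathbb{G}$-preenvelope of $N$ is a homomorphism $N \to G$ with $G$ in $\mathbb{G}$ such that each homomorphism $N \to G'$ with $G'$ in $\mathbb{G}$ factors as $N \to G \to G'$; it is a $\mathbb{G}$-envelope if each endomorphism $G \to G$ for which $N \to G \to G$ equals $N \to G$ is an automorphism. $\mathbb{G}$ is enveloping if each $R$-left-module has a $\mathbb{G}$-envelope. *)

(* Defs.v *)
From HB Require Import structures.
From mathcomp Require Import all_boot all_algebra ring_quotient.
From mathcomp Require Import boolp classical_sets functions cardinality fsbigop.

Set Implicit Arguments.
Unset Strict Implicit.
Unset Printing Implicit Defensive.

Import GRing.Theory Quotient.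

Local Open Scope ring_scope.

Section Product.
Variables (R : pzRingType) (I : Type) (M : I -> lmodType R).

Definition prodmod : Type := forall i, M i.

HB.instance Definition _ := gen_eqMixin prodmod.
HB.instance Definition _ := gen_choiceMixin prodmod.

Let zero : prodmod := fun=> 0.
Let opp (f : prodmod) : prodmod := fun i => - f i.
Let add (f g : prodmod) : prodmod := fun i => f i + g i.
Let scale (a : R) (f : prodmod) : prodmod := fun i => a *: f i.

Let addA : associative add.
Proof. by move=> f g h; apply: functional_extensionality_dep => i; apply: addrA. Qed.
Let addC : commutative add.
Proof. by move=> f g; apply: functional_extensionality_dep => i; apply: addrC. Qed.
Let add0 : left_id zero add.
Proof. by move=> f; apply: functional_extensionality_dep => i; apply: add0r. Qed.
Let addN : left_inverse zero opp add.
Proof. by move=> f; apply: functional_extensionality_dep => i; apply: addNr. Qed.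

HB.instance Definition _ := GRing.isZmodule.Build prodmod addA addC add0 addN.

Let scaleA a b f : scale a (scale b f) = scale (a * b) f.
Proof. by apply: functional_extensionality_dep => i; apply: scalerA. Qed.
Let scale1 : left_id 1 scale.
Proof. by move=> f; apply: functional_extensionality_dep => i; apply: scale1r. Qed.
Let scaleDr : right_distributive scale +%R.
Proof. by move=> a f g; apply: functional_extensionality_dep => i; apply: scalerDr. Qed.
Let scaleDl f : {morph scale^~ f : a b / a + b}.
Proof. by move=> a b; apply: functional_extensionality_dep => i; apply: scalerDl. Qed.

HB.instance Definition _ :=
  GRing.Zmodule_isLmodule.Build R prodmod scaleA scale1 scaleDr scaleDl.

End Product.

Section DirectSum.
Variables (R : pzRingType) (I : Type) (M : I -> lmodType R).

Definition finsupp_pred : {pred prodmod M} :=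
  fun f => `[< finite_set [set i | f i <> 0] >].

Fact finsupp_subproof : GRing.submod_closed finsupp_pred.
Proof.
split=> [|a f g /asboolP ff /asboolP fg]; apply/asboolP.
  by apply: sub_finite_set (@finite_set0 I) => i /=.
apply: sub_finite_set (_ : finite_set ([set i | f i <> 0] `|` [set i | g i <> 0])%classic).
  move=> i /= nz; have [fi0|] := EM (f i = 0); last by left.
  right=> gi0; apply: nz; rewrite /GRing.add /= /GRing.scale /=.
  by rewrite fi0 gi0 scaler0 addr0.
by rewrite finite_setU.
Qed.

HB.instance Definition _ :=
  GRing.isSubmodClosed.Build R (prodmod M) finsupp_pred finsupp_subproof.

Record dsum : Type := Dsum { dsum_val : prodmod M; _ : dsum_val \in finsupp_pred }.

HB.instance Definition _ := [isSub for dsum_val].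
HB.instance Definition _ := [Choice of dsum by <:].
HB.instance Definition _ := [SubChoice_isSubLmodule of dsum by <:].

Definition dsum_fun (f : dsum) : forall i : I, M i := dsum_val f.
Coercion dsum_fun : dsum >-> Funclass.

Lemma dsumP (f g : dsum) : (forall i, f i = g i) -> f = g.
Proof. by move=> fg; apply/val_inj/functional_extensionality_dep. Qed.

Lemma dsum_finite (f : dsum) : finite_set [set i | f i <> 0].
Proof. by apply/asboolP; exact: (valP f). Qed.

Lemma dsumDE (f g : dsum) i : (f + g) i = f i + g i.
Proof. by []. Qed.

Lemma dsumZE a (f : dsum) i : (a *: f) i = a *: f i.
Proof. by []. Qed.

End DirectSum.

Section Free.
Variables (R : pzRingType) (X : choiceType).

Let Rmod (x : X) : lmodType R := R^o.

Definition freemod : Type := dsum Rmod.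
HB.instance Definition _ := GRing.Lmodule.on freemod.

Fact delta_subproof (x : X) :
  ((fun y => (y == x)%:R) : prodmod Rmod) \in @finsupp_pred R X Rmod.
Proof.
apply/asboolP; apply: sub_finite_set (finite_set1 x) => y /=.
by case: eqP => // _ /(_ erefl).
Qed.

Definition delta (x : X) : freemod := Dsum (delta_subproof x).

(** The linear extension of [phi]; the terms with [a x = 0] vanish, so the sum
    over all of [X] is finitely supported. *)
Definition freelift (M : lmodType R) (phi : X -> M) (a : freemod) : M :=
  \sum_(x \in [set: X]) ((a x : R) *: phi x).

Section Lift.
Variables (M : lmodType R) (phi : X -> M).

Let freeliftE (A : set X) (a : freemod) : finite_set A ->
  (forall x, a x <> 0 -> A x) -> freelift phi a = \sum_(x \in A) ((a x : R) *: phi x).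
Proof.
move=> finA suppA; rewrite /freelift; symmetry; apply: fsbig_widen => //= x [_ nA].
by have ax0 : (a x : R) = 0; [apply: contrapT => /suppA|rewrite /preimage /= ax0 scale0r].
Qed.

Fact freelift_is_linear : linear (freelift phi).
Proof.
move=> k a b.
pose A := ([set x | a x <> 0] `|` [set x | b x <> 0])%classic.
have finA : finite_set A by rewrite finite_setU; split; apply: dsum_finite.
have suppA x : (k *: a + b) x <> 0 -> A x.
  move=> nz; have [ax0|] := EM (a x = 0); last by left.
  by right=> bx0; apply: nz; rewrite dsumDE dsumZE ax0 bx0 scaler0 addr0.
rewrite (freeliftE finA suppA) (freeliftE (a := a) finA) => [|x]; last by left.
rewrite (freeliftE (a := b) finA) => [|x]; last by right.
rewrite !fsbig_finite // scaler_sumr -big_split /=; apply: eq_bigr => x _.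
by rewrite -[LHS]/((k * (a x : R) + (b x : R)) *: phi x) scalerDl scalerA.
Qed.

HB.instance Definition _ :=
  GRing.isLinear.Build R freemod M *:%R (freelift phi) freelift_is_linear.

Lemma freelift_delta (x : X) : freelift phi (delta x) = phi x.
Proof.
rewrite (@freeliftE [set x]) //; last first.
  by move=> y /=; case: eqP => // _ /(_ erefl).
by rewrite fsbig_set1 /= eqxx scale1r.
Qed.

End Lift.
End Free.

(** Intended for additive maps, for which injectivity is exactness at [A]. *)
Definition short_exact (A B C : zmodType) (f : A -> B) (g : B -> C) : Prop :=
  [/\ injective f, forall b, g b = 0 <-> exists a, f a = b
    & forall c, exists b, g b = c].


Section Tensor.
Variable R : pzRingType.

(** Right [R]-modules are the modules over the converse ring [R^c]: for
    [n : N] and [r : R], the product [n r] is [(r : R^c) *: n]. *)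
Section Def.
Variables (N : lmodType R^c) (M : lmodType R).

Let Z := freemod int (N * M)%type.
Let gen (n : N) (m : M) : Z := delta int (n, m).

Inductive tensor_rel : Z -> Prop :=
| tensor_rel0 : tensor_rel 0
| tensor_relB x y : tensor_rel x -> tensor_rel y -> tensor_rel (x - y)
| tensor_relDl n n' m : tensor_rel (gen (n + n') m - gen n m - gen n' m)
| tensor_relDr n m m' : tensor_rel (gen n (m + m') - gen n m - gen n m')
| tensor_relZ n (r : R) m : tensor_rel (gen ((r : R^c) *: n) m - gen n (r *: m)).

Definition tensor_pred : {pred freemod int (N * M)%type} :=
  fun x => `[< tensor_rel x >].

Fact tensor_subproof : zmod_closed tensor_pred.
Proof.
split=> [|x y /asboolP rx /asboolP ry]; apply/asboolP; first exact: tensor_rel0.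
exact: tensor_relB.
Qed.

HB.instance Definition _ :=
  GRing.isZmodClosed.Build (freemod int (N * M)%type) tensor_pred tensor_subproof.

Definition tensor : zmodType := {quot tensor_pred}.

Definition tensor_pi : freemod int (N * M)%type -> tensor := \pi_{quot tensor_pred}%qT.

Definition tensor_repr (t : tensor) : freemod int (N * M)%type :=
  repr (t : {quot tensor_pred}).

Lemma tensor_reprK t : tensor_pi (tensor_repr t) = t.
Proof. exact: (reprK (qT := {quot tensor_pred})). Qed.

Fact tensor_pi_is_zmod_morphism : zmod_morphism tensor_pi.
Proof. exact: pi_is_zmod_morphism. Qed.

HB.instance Definition _ :=
  GRing.isZmodMorphism.Build (freemod int (N * M)%type) tensor tensor_pi
    tensor_pi_is_zmod_morphism.

Definition tens (n : N) (m : M) : tensor := tensor_pi (delta int (n, m)).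

Lemma tensor_piE x y : tensor_pi x = tensor_pi y <-> tensor_rel (x - y).
Proof.
have e : (x - y \in tensor_pred) = (tensor_pi x == tensor_pi y).
  exact: (idealrBE tensor_pred).
split=> [xy|rxy]; last by apply/eqP; rewrite -e; apply/asboolP.
have : x - y \in tensor_pred by rewrite e xy.
by move/asboolP.
Qed.

End Def.

Section Map.
Variables (N : lmodType R^c) (M M' : lmodType R) (f : {linear M -> M'}).

Definition tensor_pre : freemod int (N * M)%type -> freemod int (N * M')%type :=
  freelift (fun p => delta int (p.1, f p.2)).

(** [id_N] tensored with [f]; independent of the chosen representative by
    [tensor_map_pi]. *)
Definition tensor_map (t : tensor N M) : tensor N M' :=
  tensor_pi (tensor_pre (tensor_repr t)).

Lemma tensor_pre_rel x : tensor_rel x -> tensor_rel (tensor_pre x).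
Proof.
rewrite /tensor_pre; elim=> [|{}x y _ rx _ ry|n n' m|n m m'|n r m].
- by rewrite linear0; exact: tensor_rel0.
- by rewrite linearB; exact: tensor_relB.
- by rewrite !linearB /= !freelift_delta; exact: tensor_relDl.
- by rewrite !linearB /= !freelift_delta /= linearD; exact: tensor_relDr.
- by rewrite !linearB /= !freelift_delta /= linearZ; exact: tensor_relZ.
Qed.

Lemma tensor_map_pi x : tensor_map (tensor_pi x) = tensor_pi (tensor_pre x).
Proof.
apply/tensor_piE; rewrite /tensor_pre -linearB; apply: tensor_pre_rel.
by apply/tensor_piE; rewrite tensor_reprK.
Qed.

Lemma tensor_map_tens n m : tensor_map (tens n m) = tens n (f m).
Proof. by rewrite tensor_map_pi /tensor_pre freelift_delta. Qed.

Fact tensor_map_is_zmod_morphism : zmod_morphism tensor_map.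
Proof.
move=> s t.
rewrite -[s]tensor_reprK -[t]tensor_reprK -raddfB !tensor_map_pi.
by rewrite /tensor_pre linearB raddfB.
Qed.

HB.instance Definition _ :=
  GRing.isZmodMorphism.Build (tensor N M) (tensor N M') tensor_map
    tensor_map_is_zmod_morphism.

End Map.
End Tensor.

Arguments tensor_map {R} N {M M'} f t.

Definition pure_exact (R : pzRingType) (M' M M'' : lmodType R)
    (i : {linear M' -> M}) (p : {linear M -> M''}) : Prop :=
  short_exact i p /\
  forall N : lmodType R^c, short_exact (tensor_map N i) (tensor_map N p).

(** [syz_map d] maps the free module on the set [ker d] onto [ker d]. *)
Section Syzygy.
Variables (R : pzRingType) (P Q : lmodType R) (d : {linear P -> Q}).

Definition syz : lmodType R := freemod R {x : P | d x == 0}.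
Definition syz_map : {linear syz -> P} := freelift (fun x => val x).

Lemma syz_mapP x : d x = 0 <-> exists y, syz_map y = x.
Proof.
split=> [/eqP dx0|[y <-]].
  by exists (delta R (exist _ x dx0)); rewrite [LHS]freelift_delta.
rewrite [syz_map y]/(freelift _ y) /freelift linear_sum big1 // => k _.
by rewrite linearZ /= (eqP (valP k)) scaler0.
Qed.

End Syzygy.

(** [Ext^1_R(M, N)] is the first cohomology group of [Hom(P_i, N)], where
    [P2 -> P1 -> P0 -> M] is the beginning of the canonical free resolution. *)
Section Ext.
Variables (R : pzRingType) (M N : lmodType R).

Definition res0 : lmodType R := freemod R M.
Definition res_aug : {linear res0 -> M} := freelift id.
Lemma res_aug_surj m : exists x, res_aug x = m.
Proof. by exists (delta R m); exact: freelift_delta. Qed.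

Definition res1 : lmodType R := syz res_aug.
Definition res_d1 : {linear res1 -> res0} := syz_map res_aug.
Definition res2 : lmodType R := syz res_d1.
Definition res_d2 : {linear res2 -> res1} := syz_map res_d1.

Definition cocycle_pred : {pred res1 -> N} :=
  fun f => `[< linear f /\ forall x, f (res_d2 x) = 0 >].

Fact cocycle_subproof : zmod_closed cocycle_pred.
Proof.
split=> [|f g /asboolP[lf zf] /asboolP[lg zg]]; apply/asboolP.
  by split=> // a x y; rewrite [LHS]/= scaler0 addr0.
split=> [a x y|x]; last by rewrite -[LHS]/(_ - _) zf zg subr0.
by rewrite -[LHS]/(f _ - g _) lf lg scalerBr opprD addrACA.
Qed.

HB.instance Definition _ :=
  GRing.isZmodClosed.Build (res1 -> N) cocycle_pred cocycle_subproof.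

Record cocycle : Type :=
  Cocycle { cocycle_val : res1 -> N; _ : cocycle_val \in cocycle_pred }.

HB.instance Definition _ := [isSub for cocycle_val].
HB.instance Definition _ := [Choice of cocycle by <:].
HB.instance Definition _ := [SubChoice_isSubZmodule of cocycle by <:].

Definition coboundary_pred : {pred cocycle} :=
  fun f => `[< exists g : {linear res0 -> N}, forall x, cocycle_val f x = g (res_d1 x) >].

Fact coboundary_subproof : zmod_closed coboundary_pred.
Proof.
split=> [|f g /asboolP[f' ff'] /asboolP[g' gg']]; apply/asboolP.
  by exists \0.
exists (f' \- g') => x.
by rewrite -[LHS]/(cocycle_val f x - cocycle_val g x) ff' gg'.
Qed.

HB.instance Definition _ :=
  GRing.isZmodClosed.Build cocycle coboundary_pred coboundary_subproof.

Definition Ext1 : zmodType := {quot coboundary_pred}.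

Lemma Ext1_eq0P : (forall e : Ext1, e = 0) <->
  forall f : {linear res1 -> N}, (forall x, f (res_d2 x) = 0) ->
    exists g : {linear res0 -> N}, forall x, f x = g (res_d1 x).
Proof.
pose Q : zmodType := {quot coboundary_pred}.
split=> [E0 f zf|E0 e].
  have cf : (f : res1 -> N) \in cocycle_pred.
    by apply/asboolP; split=> //; exact: linearP.
  have /eqP := E0 (\pi_{quot coboundary_pred}%qT (Cocycle cf)).
  rewrite -[X in _ == X](raddf0 (\pi_{quot coboundary_pred}%qT)) -idealrBE subr0.
  by move/asboolP.
rewrite -[e](reprK (qT := {quot coboundary_pred})).
set c := repr _; have /asboolP[lc zc] := valP c.
pose F := GRing.isLinear.Build R _ N *:%R (cocycle_val c) lc.
have [g gP] := E0 (HB.pack (cocycle_val c) F) zc.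
apply/eqP; rewrite -[X in _ == X](raddf0 (\pi_{quot coboundary_pred}%qT)) -idealrBE subr0.
by apply/asboolP; exists g.
Qed.

End Ext.

Section Classes.
Variable R : pzRingType.
Implicit Types (F G : lmodType R -> Prop) (M N X Y : lmodType R).

Definition closed_iso F : Prop :=
  forall M N (f : {linear M -> N}), bijective f -> F M -> F N.

Definition closed_extension F : Prop :=
  forall M' M M'' (i : {linear M' -> M}) (p : {linear M -> M''}),
    short_exact i p -> F M' -> F M'' -> F M.

Definition closed_dsum F : Prop :=
  forall (I : Type) (M : I -> lmodType R), (forall i, F (M i)) -> F (dsum M).

Definition closed_pure_sub F : Prop :=
  forall M' M M'' (i : {linear M' -> M}) (p : {linear M -> M''}),
    pure_exact i p -> F M -> F M'.

Definition closed_pure_quotient F : Prop :=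
  forall M' M M'' (i : {linear M' -> M}) (p : {linear M -> M''}),
    pure_exact i p -> F M -> F M''.

Definition rperp F N : Prop := forall M, F M -> forall e : Ext1 M N, e = 0.
Definition lperp G M : Prop := forall N, G N -> forall e : Ext1 M N, e = 0.

Definition cotorsion_pair F G : Prop :=
  (forall N, rperp F N <-> G N) /\ (forall M, F M <-> lperp G M).

Definition precover F M X (phi : {linear X -> M}) : Prop :=
  F X /\ forall Y (psi : {linear Y -> M}), F Y ->
    exists h : {linear Y -> X}, forall y, phi (h y) = psi y.

Definition cover F M X (phi : {linear X -> M}) : Prop :=
  precover F phi /\
  forall h : {linear X -> X}, (forall x, phi (h x) = phi x) -> bijective h.

Definition covering F : Prop :=
  forall M, exists X (phi : {linear X -> M}), cover F phi.

Definition preenvelope G N X (phi : {linear N -> X}) : Prop :=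
  G X /\ forall Y (psi : {linear N -> Y}), G Y ->
    exists h : {linear X -> Y}, forall x, h (phi x) = psi x.

Definition envelope G N X (phi : {linear N -> X}) : Prop :=
  preenvelope G phi /\
  forall h : {linear X -> X}, (forall x, h (phi x) = phi x) -> bijective h.

Definition enveloping G : Prop :=
  forall N, exists X (phi : {linear N -> X}), envelope G phi.

Definition perfect_cotorsion_pair F G : Prop :=
  [/\ cotorsion_pair F G, covering F & enveloping G].

End Classes.

(* Main.v *)
Require Import Defs.
From HB Require Import structures.
From mathcomp Require Import all_boot all_algebra ring_quotient.
From mathcomp Require Import boolp classical_sets functions cardinality fsbigop.
From mathcomp Require Import finmap.
From mathcomp Require wochoice.

(** Fix a linear map [theta : N -> M] and consider its factorizations
    [N -> G -> M] with [N -> G] injective and [G / N] in [F]. The heart of the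
    proof is that among them there is a weakly terminal one, to which all others
    map, whose endomorphisms are all bijective ([exists_minimal_terminal]). Covers
    and envelopes are the two extreme cases.

    For [N = 0] a factorization is a module of [F] over [M], and such a minimal
    weakly terminal object is an [F]-cover ([exists_cover]). For [M = 0] it is an
    extension [N -> G -> A] with [A] in [F]. Then [G] lies in [rperp F]: an extension
    [H] of a module of [F] by [G] is again a factorization, because [F] is closed
    under extensions, so it maps to [G] under [N], and the restriction of this map
    to [G] is an automorphism; hence [H] splits. Maps from [N] to modules of
    [rperp F] extend to [G] because [A] is in [F], so [G] is an envelope
    ([exists_special_envelope]). Applied to the kernel of a free module mapping
    onto [M], such an envelope also shows that [M] is in [F] as soon as it is in
    [lperp (rperp F)] ([lperp_rperp]).

    A weakly terminal factorization exists because all factorizations map to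
    members of a set of them, which can be amalgamated over [N]. To find the set,
    divide [G] by a maximal submodule [D] that is contained in the kernel of
    [G -> M], meets [N] trivially and has pure image in [G / N] ([reduce]). When no
    such [D] is left, [G] is bounded in terms of [R], [N] and [M] ([reduced_inj]).
    This is a form of the lemma behind the flat cover theorem of Bican, El Bashir
    and Enochs. Close each element [m] under solutions of finite systems of
    linear equations, up to errors in [N], where the solutions are chosen so that
    differences of solutions solve the system of the differences. Two elements [m]
    and [m'] that yield the same errors and the same images in [M] then have
    differences that form a submodule [D] as above, so [m = m'].

    Minimality follows Enochs. As [F] is closed under direct sums and pure
    quotients, it is closed under directed colimits ([colimit]), so a transfinite
    chain of endomorphisms of a weakly terminal [T] always has a cone in [T]. Long
    chains along which kernels, or images, increase strictly are impossible for
    reasons of cardinality. Maximality of kernels leads to a weakly terminal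
    object with only injective endomorphisms, and a chain of images shows that
    these are surjective. *)

Set Implicit Arguments.
Unset Strict Implicit.
Unset Printing Implicit Defensive.

Import GRing.Theory Quotient.

Local Open Scope ring_scope.

(** * Submodules, quotients and linear maps *)
Lemma lin_of (R : pzRingType) (U V : lmodType R) (f : U -> V) :
  linear f -> exists g : {linear U -> V}, forall x, g x = f x.
Proof.
move=> lf; pose g := GRing.isLinear.Build R U V *:%R f lf.
pose h : {linear U -> V} := HB.pack f g.
by exists h.
Qed.

Section Submodule.
Variables (R : pzRingType) (M : lmodType R).

Record submod := Submod { sub_set :> M -> Prop;
  _ : [/\ sub_set 0, forall x y, sub_set x -> sub_set y -> sub_set (x + y)
        & forall a x, sub_set x -> sub_set (a *: x)] }.

Implicit Types P : submod.

Lemma submod0 P : P 0. Proof. by case: P => ? []. Qed.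
Lemma submodD P x y : P x -> P y -> P (x + y).
Proof. by case: P => ? [? h ?] /=; apply: h. Qed.
Lemma submodZ P a x : P x -> P (a *: x).
Proof. by case: P => ? [? ? h] /=; apply: h. Qed.

Definition sub_pred P : {pred M} := fun x => `[<P x>].

Fact sub_pred_closed P : GRing.submod_closed (sub_pred P).
Proof.
split=> [|a x y /asboolP Px /asboolP Py]; apply/asboolP; first exact: submod0.
by apply: submodD => //; apply: submodZ.
Qed.

HB.instance Definition _ P :=
  GRing.isSubmodClosed.Build R M (sub_pred P) (sub_pred_closed P).

Record submod_type P := SubmodType { submod_val : M; _ : submod_val \in sub_pred P }.

HB.instance Definition _ P := [isSub for @submod_val P].
HB.instance Definition _ P := [Choice of submod_type P by <:].
HB.instance Definition _ P := [SubChoice_isSubLmodule of submod_type P by <:].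

Lemma submod_inclusion P : exists (D : lmodType R) (i : {linear D -> M}),
  injective i /\ forall x, P x <-> exists d, i d = x.
Proof.
exists (submod_type P : lmodType R), (\val : {linear submod_type P -> M}).
split=> [|x]; first exact: val_inj.
split=> [Px|[[d Pd] <-]]; last exact/asboolP.
have Px' : x \in sub_pred P by apply/asboolP.
by exists (SubmodType Px').
Qed.

Definition quot_carrier P : zmodType := {quot sub_pred P}.
Definition quotmod P : Type := quot_carrier P.
HB.instance Definition _ P := GRing.Zmodule.on (quotmod P).

Definition quot_pi P : M -> quotmod P := \pi_{quot sub_pred P}%qT.

Fact quot_pi_is_zmod_morphism P : zmod_morphism (@quot_pi P).
Proof. exact: pi_is_zmod_morphism. Qed.

HB.instance Definition _ P :=
  GRing.isZmodMorphism.Build M (quotmod P) (@quot_pi P) (quot_pi_is_zmod_morphism P).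

Lemma quot_pi_eq0 P x : quot_pi P x = 0 <-> P x.
Proof.
have e : (x - 0 \in sub_pred P) = (quot_pi P x == quot_pi P 0).
  exact: (idealrBE (sub_pred P)).
rewrite subr0 raddf0 in e; split=> [/eqP|Px]; first by rewrite -e => /asboolP.
by apply/eqP; rewrite -e; apply/asboolP.
Qed.

Lemma quot_pi_surj P (y : quotmod P) : exists x, quot_pi P x = y.
Proof. exists (repr (y : {quot sub_pred P})); exact: (reprK (qT := {quot sub_pred P})). Qed.

Let scale P (a : R) (y : quotmod P) : quotmod P :=
  quot_pi P (a *: repr (y : {quot sub_pred P})).

Let scale_pi P a x : scale a (quot_pi P x) = quot_pi P (a *: x).
Proof.
apply/eqP; rewrite -subr_eq0 -raddfB -scalerBr; apply/eqP/quot_pi_eq0/submodZ.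
apply/quot_pi_eq0; rewrite raddfB /=; apply/eqP; rewrite subr_eq0.
by apply/eqP; exact: (reprK (qT := {quot sub_pred P})).
Qed.

Let scaleA P a b y : @scale P a (scale b y) = scale (a * b) y.
Proof. by have [x <-] := quot_pi_surj y; rewrite !scale_pi scalerA. Qed.
Let scale1 P : left_id 1 (@scale P).
Proof. by move=> y; have [x <-] := quot_pi_surj y; rewrite scale_pi scale1r. Qed.
Let scaleDr P : right_distributive (@scale P) +%R.
Proof.
move=> a y y'; have [x <-] := quot_pi_surj y; have [x' <-] := quot_pi_surj y'.
by rewrite -raddfD !scale_pi scalerDr raddfD.
Qed.
Let scaleDl P y : {morph (@scale P)^~ y : a b / a + b}.
Proof.
move=> a b; have [x <-] := quot_pi_surj y.
by rewrite !scale_pi scalerDl raddfD.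
Qed.

HB.instance Definition _ P :=
  GRing.Zmodule_isLmodule.Build R (quotmod P) (@scaleA P) (@scale1 P) (@scaleDr P) (@scaleDl P).

Lemma quotient P : exists (Q : lmodType R) (p : {linear M -> Q}),
  (forall y, exists x, p x = y) /\ forall x, p x = 0 <-> P x.
Proof.
have lp : linear (@quot_pi P).
  by move=> a x y; rewrite raddfD; congr (_ + _); exact: esym (scale_pi P a x).
have [p pE] := lin_of lp; exists (quotmod P : lmodType R), p; split=> [y|x].
  by have [x <-] := quot_pi_surj y; exists x.
by rewrite pE; exact: quot_pi_eq0.
Qed.

End Submodule.

Section LinearMaps.
Variable R : pzRingType.
Implicit Types M Q Y : lmodType R.

Lemma ker_eq M Q (p : {linear M -> Q}) x y : p (x - y) = 0 <-> p x = p y.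
Proof.
rewrite linearB; split=> [/eqP|->]; last exact: subrr.
by rewrite subr_eq0 => /eqP.
Qed.

Lemma factor_surj M Q Y (p : {linear M -> Q}) (f : {linear M -> Y}) :
  (forall y, exists x, p x = y) -> (forall x, p x = 0 -> f x = 0) ->
  exists g : {linear Q -> Y}, forall x, g (p x) = f x.
Proof.
move=> /choice[s ps] pf.
have fs x : f (s (p x)) = f x by apply/ker_eq/pf/ker_eq.
have lg : linear (f \o s).
  move=> a y z; rewrite /= -{1}(ps y) -{1}(ps z) -linearP fs linearP.
  by [].
by have [g gE] := lin_of lg; exists g => x; rewrite gE /= fs.
Qed.

Lemma factor_inj M Q Y (i : {linear M -> Q}) (f : {linear Y -> Q}) :
  injective i -> (forall y, exists x, i x = f y) ->
  exists g : {linear Y -> M}, forall y, i (g y) = f y.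
Proof.
move=> inj_i /choice[s sE].
have ls : linear s by move=> a y z; apply: inj_i; rewrite linearP !sE linearP.
by have [g gE] := lin_of ls; exists g => y; rewrite gE.
Qed.

Lemma ker_submod M Q (p : {linear M -> Q}) :
  exists P : submod M, forall x, P x <-> p x = 0.
Proof.
unshelve eexists (@Submod R M (fun x => p x = 0) _) => //; split=> [|x y px py|a x px].
- exact: linear0.
- by rewrite linearD px py addr0.
- by rewrite linearZ /= px scaler0.
Qed.

Lemma range_submod M Q (i : {linear M -> Q}) :
  exists P : submod Q, forall y, P y <-> exists x, i x = y.
Proof.
unshelve eexists (@Submod R Q (fun y => exists x, i x = y) _) => //; split.
- by exists 0; exact: linear0.
- by move=> _ _ [x <-] [y <-]; exists (x + y); exact: linearD.
- by move=> a _ [x <-]; exists (a *: x); exact: linearZ.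
Qed.

End LinearMaps.

(** * Direct sums and free modules *)
Section DirectSum.
Variables (R : pzRingType) (I : Type) (D : I -> lmodType R).

(** [I] need not have decidable equality, so the comparison of indices is
    classical and the value is transported along it. *)
Definition inj_fun (i : I) (x : D i) : prodmod D :=
  fun j => if pselect (i = j) is left e then ecast k (D k) e x else 0.

Fact inj_fun_finsupp i x : @inj_fun i x \in @finsupp_pred R I D.
Proof.
apply/asboolP; apply: sub_finite_set (finite_set1 i) => j /=.
by rewrite /inj_fun; case: pselect.
Qed.

Definition dsum_in i x : dsum D := Dsum (inj_fun_finsupp (i := i) x).

Lemma dsum_in_id i (x : D i) : dsum_in x i = x.
Proof.
rewrite /dsum_in /dsum_fun /= /inj_fun; case: pselect => // e.
by rewrite (Prop_irrelevance e erefl).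
Qed.

Lemma dsum_in_neq i j (x : D i) : i <> j -> dsum_in x j = 0.
Proof. by rewrite /dsum_in /dsum_fun /= /inj_fun; case: pselect. Qed.

Lemma dsum_in_linear i : linear (@dsum_in i).
Proof.
move=> a x y; apply: dsumP => j; rewrite dsumDE dsumZE.
have [e|ne] := EM (i = j); first by case: _ / e; rewrite !dsum_in_id.
by rewrite !dsum_in_neq // scaler0 addr0.
Qed.

HB.instance Definition _ i :=
  GRing.isLinear.Build R (D i) (dsum D) *:%R (@dsum_in i) (@dsum_in_linear i).

Lemma dsum_sum (A : set {classic I}) (s : dsum D) : finite_set A ->
  (forall i, s i <> 0 -> A i) -> s = \sum_(i \in A) dsum_in (s i).
Proof.
move=> finA suppA; apply: dsumP => i; rewrite fsbig_finite //.
have evalE (r : seq {classic I}) : (\sum_(k <- r) dsum_in (s k)) i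
    = \sum_(k <- r) (dsum_in (s k) i : D i).
  by elim: r => [|k r IH]; rewrite ?big_nil // !big_cons -IH.
rewrite evalE; have [/suppA Ai|/contrapT s0] := EM (s i <> 0).
  have iA : (i : {classic I}) \in fset_set A by rewrite in_fset_set //; apply: mem_set.
  rewrite (bigD1_seq (i : {classic I}) iA) ?fset_uniq //.
  rewrite dsum_in_id big1 => [|k /eqP ki]; first exact: esym (addr0 _).
  exact: dsum_in_neq.
rewrite s0 big1 // => k _; have [e|ne] := EM (k = i); last exact: dsum_in_neq.
by case: _ / e s0 => s0; rewrite dsum_in_id.
Qed.

Lemma dsum_ind (P : dsum D -> Prop) : P 0 -> (forall x y, P x -> P y -> P (x + y)) ->
  (forall i (x : D i), P (dsum_in x)) -> forall s, P s.
Proof.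
move=> P0 PD Pin s.
rewrite (@dsum_sum [set i : {classic I} | s i <> 0] s) //; last exact: dsum_finite.
have sumP (r : seq {classic I}) : P (\sum_(k <- r) dsum_in (s k)).
  elim: r => [|i r IH]; first by rewrite big_nil.
  by rewrite big_cons; apply: PD.
by rewrite fsbig_finite; [exact: sumP|exact: dsum_finite].
Qed.

Lemma dsum_eq (Y : lmodType R) (f g : {linear dsum D -> Y}) :
  (forall i x, f (@dsum_in i x) = g (dsum_in x)) -> forall s, f s = g s.
Proof.
move=> fg; apply: dsum_ind => //; first by rewrite !linear0.
by move=> x y fx fy; rewrite !linearD fx fy.
Qed.

Lemma dsum_lift (Y : lmodType R) (phi : forall i, {linear D i -> Y}) :
  exists f : {linear dsum D -> Y}, forall i x, f (@dsum_in i x) = phi i x.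
Proof.
pose f (s : dsum D) : Y := \sum_(i \in [set: {classic I}]) phi i (s i).
have fE (A : set {classic I}) (s : dsum D) : finite_set A ->
    (forall i, s i <> 0 -> A i) -> f s = \sum_(i \in A) phi i (s i).
  move=> finA suppA; rewrite /f; symmetry; apply: fsbig_widen => //= i [_ nA].
  by rewrite /preimage /= (_ : s i = 0) ?linear0 //; apply: contrapT => /suppA.
have lf : linear f.
  move=> k a b.
  pose A := ([set i : {classic I} | a i <> 0] `|` [set i | b i <> 0])%classic.
  have finA : finite_set A by rewrite finite_setU; split; apply: dsum_finite.
  rewrite !(fE A) // => [|i|i|i]; [|by right|by left|]; last first.
    move=> nz; have [a0|] := EM (a i = 0); last by left.
    by right=> b0; apply: nz; rewrite dsumDE dsumZE a0 b0 scaler0 addr0.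
  rewrite !fsbig_finite // scaler_sumr -big_split /=; apply: eq_bigr => i _.
  exact: (linearP (phi i)).
have [g gE] := lin_of lf; exists g => i x.
rewrite gE (fE [set (i : {classic I})]%classic) ?fsbig_set1 ?dsum_in_id //.
by move=> j nz; apply: contrapT => ij; apply: nz; apply: dsum_in_neq => /esym.
Qed.

End DirectSum.

Arguments dsum_in {R I} D i x.

Section Zero.
Variable R : pzRingType.

Definition zeromod : lmodType R := dsum (fun _ : void => (R^o : lmodType R)).

Lemma zeromod0 (x : zeromod) : x = 0. Proof. by apply: dsumP => -[]. Qed.

End Zero.

Section Free.
Variables (R : pzRingType) (X : choiceType).

Lemma freemod_ind (P : freemod R X -> Prop) : P 0 ->
  (forall x y, P x -> P y -> P (x + y)) ->
  (forall a x, P (a *: delta R x)) -> forall s, P s.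
Proof.
move=> P0 PD Pd; apply: dsum_ind => // i x.
suff -> : dsum_in (fun _ : X => (R^o : lmodType R)) i x = (x : R) *: delta R i.
  exact: Pd.
apply: dsumP => j; rewrite dsumZE /delta {2}/dsum_fun /=.
case: (eqVneq j i) => [->|/eqP ne].
  by apply: etrans (dsum_in_id _) _; exact: esym (mulr1 _).
apply: etrans (dsum_in_neq _ _) _; first by move/esym.
exact: esym (mulr0 _).
Qed.

Lemma freemod_eq (Y : lmodType R) (f g : {linear freemod R X -> Y}) :
  (forall x, f (delta R x) = g (delta R x)) -> forall s, f s = g s.
Proof.
move=> fg; apply: freemod_ind; first by rewrite !linear0.
  by move=> x y fx fy; rewrite !linearD fx fy.
by move=> a x; rewrite !linearZ /= fg.
Qed.

Lemma freemod_surj (Y : lmodType R) (phi : X -> Y) :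
  (forall y, exists x, phi x = y) -> forall y, exists s, freelift phi s = y.
Proof. by move=> surj y; have [x <-] := surj y; exists (delta R x); exact: freelift_delta. Qed.

End Free.

(** * Purity *)
Section LocallyPure.
Variable R : pzRingType.

(** Every finite piece of [G] can be retracted into [D] by a map that respects
    the additive and scalar relations holding modulo [ker q]. For [q] the
    identity this is the solvability criterion for [D] to be a pure submodule
    of [G]. In general it says that [q] is injective on [D] with pure image, and
    this is the form needed here: [D] can then be divided out of an extension
    [ker q -> G -> A] while keeping [ker q] and replacing [A] by a pure quotient. *)
Definition locally_pure (G A : lmodType R) (q : {linear G -> A}) (D : G -> Prop) :=
  forall (S : seq G) (T : seq R), exists s : G -> G,
    [/\ forall x, x \in S -> D (s x), forall x, x \in S -> D x -> s x = x,
        forall x y z, x \in S -> y \in S -> z \in S ->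
          q (x + y) = q z -> s x + s y = s z
      & forall a x y, a \in T -> x \in S -> y \in S ->
          q (a *: x) = q y -> a *: s x = s y].

End LocallyPure.

Section TensorElements.
Variables (R : pzRingType) (N : lmodType R^c).

(** An integer multiple is reached by addition and negation alone. *)
Lemma freeZ_ind (X : choiceType) (P : freemod int X -> Prop) : P 0 ->
  (forall x y, P x -> P y -> P (x + y)) -> (forall x, P x -> P (- x)) ->
  (forall x, P (delta int x)) -> forall s, P s.
Proof.
move=> P0 PD PN Pd; apply: freemod_ind => // a x.
have Pn n : P (n%:R *: delta int x).
  by elim: n => [|n IH]; rewrite ?scale0r // -natr1 scalerDl scale1r; apply: PD.
case: a => n; first by rewrite -[Posz n]natz; apply: Pn.
by rewrite NegzE scaleNr -natz; apply: PN.
Qed.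

Section TensElements.
Variable M : lmodType R.

Lemma tensDl n n' (m : M) : tens (n + n' : N) m = tens n m + tens n' m.
Proof.
rewrite /tens -raddfD; apply/tensor_piE; rewrite opprD addrA; exact: tensor_relDl.
Qed.

Lemma tensDr (n : N) (m m' : M) : tens n (m + m') = tens n m + tens n m'.
Proof.
rewrite /tens -raddfD; apply/tensor_piE; rewrite opprD addrA; exact: tensor_relDr.
Qed.

Lemma tensZ (n : N) (r : R) (m : M) : tens ((r : R^c) *: n) m = tens n (r *: m).
Proof. by apply/tensor_piE; exact: tensor_relZ. Qed.

Lemma tensNr (n : N) (m : M) : tens n (- m) = - tens n m.
Proof.
have t0 : tens n (0 : M) = 0.
  by apply: (@addrI _ (tens n 0)); rewrite -tensDr !addr0.
by apply/eqP; rewrite -addr_eq0 -tensDr addNr t0.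
Qed.

Lemma tensor_ind (P : tensor N M -> Prop) : P 0 ->
  (forall x y, P x -> P y -> P (x + y)) -> (forall x, P x -> P (- x)) ->
  (forall n m, P (tens n m)) -> forall t, P t.
Proof.
move=> P0 PD PN Pt t; rewrite -[t]tensor_reprK; move: (tensor_repr t).
apply: freeZ_ind => [|x y|x|[n m]]; rewrite ?raddf0 ?raddfD ?raddfN //.
- exact: PD.
- exact: PN.
- exact: Pt.
Qed.

End TensElements.

Section RightExact.
Variables (M' M M'' : lmodType R) (i : {linear M' -> M}) (p : {linear M -> M''}).
Hypothesis ex : short_exact i p.

Lemma tensor_surj t : exists u, tensor_map N p u = t.
Proof.
have [_ _ surj] := ex.
elim/tensor_ind: t => [|_ _ [x <-] [y <-]|_ [x <-]|n m].
- by exists 0; rewrite raddf0.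
- by exists (x + y); rewrite raddfD.
- by exists (- x); rewrite raddfN.
- by have [b <-] := surj m; exists (tens n b); exact: tensor_map_tens.
Qed.

Let im (t : tensor N M) := exists u, tensor_map N i u = t.

Let imD x y : im x -> im y -> im (x + y).
Proof. by move=> [u <-] [v <-]; exists (u + v); exact: raddfD. Qed.
Let imN x : im x -> im (- x).
Proof. by move=> [u <-]; exists (- u); exact: raddfN. Qed.

Let im_tens n m : p m = 0 -> im (tens n m).
Proof.
by have [_ /(_ m)[+ _] _] := ex => h /h[a <-]; exists (tens n a); exact: tensor_map_tens.
Qed.

(** With [s] a set-theoretic section of [p], the additive map sending [(n, c)]
    to [n (x) s c] is an inverse of [tensor_map N p] modulo the image of
    [tensor_map N i], since [s] is linear up to [ker p]. *)
Lemma tensor_middle t : tensor_map N p t = 0 <-> im t.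
Proof.
have [_ mid /choice[s ps]] := ex.
have pi0 a : p (i a) = 0 by apply/mid; exists a.
split=> [|[u <-]]; last first.
  elim/tensor_ind: u => [|x y px py|x px|n m]; rewrite ?raddf0 ?raddfD ?raddfN //=.
  - by rewrite px py addr0.
  - by rewrite px oppr0.
  - have t0 : tens n (0 : M'') = 0.
      by apply: (@addrI _ (tens n 0)); rewrite -tensDr !addr0.
    by rewrite !tensor_map_tens pi0 t0.
pose sec : {linear freemod int (N * M'')%type -> freemod int (N * M)%type} :=
  freelift (fun c => delta int (c.1, s c.2)).
have secE n c : tensor_pi (sec (delta int (n, c))) = tens n (s c).
  by rewrite [sec _]freelift_delta.
have sec_rel z : tensor_rel z -> im (tensor_pi (sec z)).
  elim=> [|x y _ ix _ iy|n n' m|n m m'|n r m].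
  - by rewrite linear0 raddf0; exists 0; exact: raddf0.
  - by rewrite linearB raddfB; apply: imD => //; apply: imN.
  - rewrite !linearB !raddfB /= !secE tensDl.
    by rewrite addrAC addrK subrr; exists 0; exact: raddf0.
  - rewrite !linearB !raddfB /= !secE -!tensNr -!tensDr.
    by apply: im_tens; rewrite !(raddfB p) /= !ps addrAC addrK subrr.
  - rewrite !linearB !raddfB /= !secE tensZ -!tensNr -!tensDr.
    by apply: im_tens; rewrite (raddfB p) /= (linearZ_LR p) /= !ps subrr.
pose pr : {linear freemod int (N * M)%type -> freemod int (N * M'')%type} :=
  freelift (fun c => delta int (c.1, p c.2)).
have sec_inv x : im (tensor_pi x - tensor_pi (sec (pr x))).
  elim/freeZ_ind: x => [|x y ix iy|x ix|[n m]].
  - by rewrite !linear0 raddf0 subr0; exists 0; exact: raddf0.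
  - rewrite (linearD pr) (linearD sec) !(raddfD (@tensor_pi R N M)) opprD addrACA.
    exact: imD.
  - rewrite (linearN pr) (linearN sec) !(raddfN (@tensor_pi R N M)) -opprD.
    exact: imN.
  - rewrite [pr _]freelift_delta secE -/(tens _ _) -tensNr -tensDr.
    by apply: im_tens; rewrite (raddfB p) /= ps subrr.
rewrite -[t]tensor_reprK; move: (tensor_repr t) => x.
rewrite tensor_map_pi -[X in _ = X](raddf0 (@tensor_pi R N M'')) => /tensor_piE.
rewrite subr0 => /sec_rel h; rewrite -[tensor_pi x](subrK (tensor_pi (sec (pr x)))).
exact: imD.
Qed.

(** A relation that holds in [N (x) M] has a derivation, which mentions finitely
    many elements of [M]; a local retraction for those elements turns it into a
    derivation in [N (x) M']. *)
Lemma tensor_inj : locally_pure (idfun : {linear M -> M}) (fun x => p x = 0) ->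
  injective (tensor_map N i).
Proof.
have [inj_i mid _] := ex.
move=> pure; apply: raddf_inj => t /=; rewrite -[t]tensor_reprK.
move: (tensor_repr t) => y; rewrite tensor_map_pi.
rewrite -[X in _ = X](raddf0 (@tensor_pi R N M)) => /tensor_piE; rewrite subr0 => rel.
pose pre (s : M -> M') : {linear freemod int (N * M)%type -> freemod int (N * M')%type} :=
  freelift (fun c => delta int (c.1, s c.2)).
have preE s n m : pre s (delta int (n, m)) = delta int (n, s m).
  by rewrite [LHS]freelift_delta.
pose prei : {linear freemod int (N * M')%type -> freemod int (N * M)%type} :=
  freelift (fun c => delta int (c.1, i c.2)).
have preiE n m : prei (delta int (n, m)) = delta int (n, i m).
  by rewrite [LHS]freelift_delta.
have {}rel : tensor_rel (prei y) by [].
have [S1 [T1 relP]] : exists (S : seq M) (T : seq R), forall s : M -> M',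
    (forall x y, x \in S -> y \in S -> x + y \in S -> s (x + y) = s x + s y) ->
    (forall a x, a \in T -> x \in S -> a *: x \in S -> s (a *: x) = a *: s x) ->
    tensor_rel (pre s (prei y)).
  elim: rel => [|u v _ [S [T hu]] _ [S' [T' hv]]|n n' m|n m m'|n r m].
  - by exists [::], [::] => s _ _; rewrite (linear0 (pre s)); exact: tensor_rel0.
  - exists (S ++ S'), (T ++ T') => s sD sZ; rewrite (linearB (pre s)); apply: tensor_relB.
      apply: hu => [x y' xS yS xyS|a x aT xS axS]; [apply: sD|apply: sZ];
      by rewrite mem_cat ?xS ?yS ?xyS ?aT ?axS.
    apply: hv => [x y' xS yS xyS|a x aT xS axS]; [apply: sD|apply: sZ];
      by rewrite mem_cat ?xS ?yS ?xyS ?aT ?axS orbT.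
  - exists [::], [::] => s _ _; rewrite !(linearB (pre s)) !preE; exact: tensor_relDl.
  - exists [:: m; m'; m + m'], [::] => s sD _; rewrite !(linearB (pre s)) !preE.
    by rewrite sD ?inE ?eqxx ?orbT //; exact: tensor_relDr.
  - exists [:: m; r *: m], [:: r] => s _ sZ; rewrite !(linearB (pre s)) !preE.
    by rewrite sZ ?inE ?eqxx ?orbT //; exact: tensor_relZ.
have [S2 fixP] : exists S : seq M, forall s : M -> M',
    (forall x, i x \in S -> s (i x) = x) -> pre s (prei y) = y.
  elim/freeZ_ind: y {rel relP} => [|u v [S hu] [S' hv]|u [S hu]|[n m]].
  - by exists [::] => s _; rewrite !linear0.
  - exists (S ++ S') => s fs; rewrite !linearD hu ?hv // => x xS; apply: fs;
    by rewrite mem_cat xS ?orbT.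
  - by exists S => s fs; rewrite !linearN hu.
  - by exists [:: i m] => s fs; rewrite preiE preE fs ?inE.
have [s [sD sfix sadd sscale]] := pure (S1 ++ S2) T1.
have /choice[u uE] : forall x, exists z, x \in S1 ++ S2 -> i z = s x.
  move=> x; have [xS|] := boolP (x \in _); last by exists 0.
  by have /mid[z zE] := sD x xS; exists z.
rewrite -[X in _ = X](raddf0 (@tensor_pi R N M')); apply/tensor_piE; rewrite subr0.
rewrite -(fixP u) => [|x xS]; last first.
  have xS' : i x \in S1 ++ S2 by rewrite mem_cat xS orbT.
  by apply: inj_i; rewrite uE // sfix //; apply/mid; exists x.
have inS x : x \in S1 -> x \in S1 ++ S2 by rewrite mem_cat => ->.
apply: relP => [x z /inS xS /inS zS /inS xzS|a x aT /inS xS /inS axS]; apply: inj_i.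
  by rewrite linearD !uE //; apply/esym/sadd.
by rewrite linearZ /= !uE //; apply/esym/sscale.
Qed.

End RightExact.
End TensorElements.

Section LocallyPureExact.
Variable R : pzRingType.

Lemma pure_exact_of_local (M' M M'' : lmodType R) (i : {linear M' -> M})
    (p : {linear M -> M''}) : short_exact i p ->
  locally_pure (idfun : {linear M -> M}) (fun x => p x = 0) -> pure_exact i p.
Proof.
move=> ex pure; split=> // N; split.
- exact: (@tensor_inj _ N _ _ _ i p ex pure).
- exact: (@tensor_middle _ N _ _ _ i p ex).
- exact: (@tensor_surj _ N _ _ _ i p ex).
Qed.

Variable F : lmodType R -> Prop.
Hypothesis F_pure_quotient : closed_pure_quotient F.

Lemma local_pure_quotient (M M'' : lmodType R) (p : {linear M -> M''}) :
  (forall y, exists x, p x = y) ->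
  locally_pure (idfun : {linear M -> M}) (fun x => p x = 0) -> F M -> F M''.
Proof.
move=> surj pure FM; have [P PE] := ker_submod p.
have [D [i [inj_i iE]]] := submod_inclusion P.
apply: (F_pure_quotient (i := i) (p := p)) FM; apply: pure_exact_of_local => //.
by split=> // x; rewrite -iE PE.
Qed.

Lemma split_quotient (M M'' : lmodType R) (p : {linear M -> M''}) (s : {linear M'' -> M}) :
  (forall y, p (s y) = y) -> F M -> F M''.
Proof.
move=> ps; apply: (local_pure_quotient (p := p)) => [y|S T]; first by exists (s y).
exists (fun x => x - s (p x)); split=> [x _|x _ ->|x y z _ _ _ /= <-|a x y _ _ _ /= <-].
- by rewrite linearB /= ps subrr.
- by rewrite linear0 subr0.
- by rewrite (linearD p) (linearD s) opprD addrACA.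
- by rewrite (linearZ_LR p) (linearZ_LR s) -scalerBr.
Qed.

End LocallyPureExact.

(** * Bounding modules without pure submodules *)
Section Bound.
Variable R : pzRingType.

(** The equations [v_i + v_j = v_k] and [a v_i = v_j] between unknowns indexed
    by naturals; auxiliary unknowns reduce every finite linear system to them. *)
Definition lineq : eqType := ((nat * nat * nat) + (R * nat * nat))%type.

Definition defect (G : lmodType R) (e : lineq) (v : nat -> G) : G :=
  match e with
  | inl (i, j, k) => v i + v j - v k
  | inr (a, i, j) => a *: v i - v j
  end.

Lemma defectB (G : lmodType R) e (v w : nat -> G) :
  defect e (fun i => v i - w i) = defect e v - defect e w.
Proof.
case: e => [[[i j] k]|[[a i] j]] /=.
  rewrite (addrACA (v i)) -(opprD (w i)) (opprD (v k)) addrACA.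
  by rewrite -(opprD (w i + w j)).
by rewrite scalerBr (opprD (v j)) addrACA -(opprD (a *: w i)).
Qed.

(** Names for what a single generator yields when finite systems are solved
    again and again: [Sol es args i] is the [i]-th unknown of the system [es]
    whose first unknowns are prescribed by [args]. These names do not refer to
    any module, which is what makes the bound [reduced_inj] uniform. *)
Inductive solterm := Gen | Sol of seq lineq & seq solterm & nat.

(** The system has to hold only up to [ker q]. *)
Definition solution (G A : lmodType R) (q : {linear G -> A}) (es : seq lineq) n (c y : nat -> G) :=
  (forall i, (i < n)%N -> y i = c i) /\
  forall e, e \in es -> q (defect e y) = 0.

Section Differences.
Variables (G A : lmodType R) (q : {linear G -> A}).
Implicit Types (c y : nat -> G) (es : seq lineq).

Lemma solutionB es n c c' y y' : solution q es n c y -> solution q es n c' y' ->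
  solution q es n (fun i => c i - c' i) (fun i => y i - y' i).
Proof.
move=> [yc ye] [yc' ye']; split=> [i lt_in|e ein]; first by rewrite yc ?yc'.
by rewrite defectB linearB ye ?ye' ?subrr.
Qed.

(** The constants for which a system is solvable form a subgroup. Solving for
    [c - rho c], where [rho c] is a fixed representative of the coset of [c],
    gives values whose differences solve the system for [c - c'] modulo [ker q]
    as soon as it is solvable, even if it is solvable neither for [c] nor for [c']. *)
Lemma exists_solver : exists sol : seq lineq -> nat -> (nat -> G) -> nat -> G,
  (forall es n c e, e \in es -> q (defect e (sol es n c)) = 0) /\
  forall es n c c', (exists y, solution q es n (fun i => c i - c' i) y) ->
    forall i, (i < n)%N -> sol es n c i - sol es n c' i = c i - c' i.
Proof.
suff /choice[s sP] : forall a : seq lineq * nat, exists sol : (nat -> G) -> nat -> G,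
    (forall c e, e \in a.1 -> q (defect e (sol c)) = 0) /\
    forall c c', (exists y, solution q a.1 a.2 (fun i => c i - c' i) y) ->
      forall i, (i < a.2)%N -> sol c i - sol c' i = c i - c' i.
  exists (fun es n => s (es, n)); split=> [es n|es n]; first exact: (sP (es, n)).1.
  exact: (sP (es, n)).2.
move=> [es n] /=.
pose H c := exists y, solution q es n c y.
have HB c c' : H c -> H c' -> H (fun i => c i - c' i).
  by move=> [y yP] [y' yP']; exists (fun i => y i - y' i); exact: solutionB.
have H0 : H (fun=> 0).
  exists (fun=> 0); split=> // -[[[i j] k]|[[a i] j]] _ /=.
    by rewrite addr0 subr0 linear0.
  by rewrite scaler0 subr0 linear0.
pose coset c : (nat -> G) -> Prop := fun c' => H (fun i => c i - c' i).
have /choice[rho rhoP] : forall K : (nat -> G) -> Prop, exists r, forall c, K c -> K r.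
  move=> K.
  have [[c Kc]|K0] := EM (exists c, K c); first by exists c.
  by exists (fun=> 0) => c Kc; case: K0; exists c.
have cosetP c : coset c (rho (coset c)).
  apply: (rhoP _ c); rewrite /coset /=.
  by rewrite (_ : (fun _ => _) = fun=> 0) //; apply/funext => i; rewrite subrr.
have coset_eq c c' : H (fun i => c i - c' i) -> coset c = coset c'.
  move=> cc'; apply/predeqP => d; split=> h.
    rewrite /coset /= (_ : (fun _ => _) =
      fun i => (c i - d i) - (c i - c' i)); first exact: HB h cc'.
    by apply/funext => i; rewrite opprB [RHS]addrC addrA subrK.
  have c'c : H (fun i => 0 - (c i - c' i)) by exact: HB H0 cc'.
  rewrite /coset /= (_ : (fun _ => _) =
    fun i => (c' i - d i) - (0 - (c i - c' i))); first exact: HB h c'c.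
  by apply/funext => i; rewrite sub0r opprK [RHS]addrC addrA subrK.
have /choice[s sP] := cosetP.
exists s; split=> [c e ein|c c' cc' i lt_in]; first by case: (sP c) => _; exact.
case: (sP c) (sP c') => [sc _] [sc' _]; rewrite sc // sc' // (coset_eq _ _ cc').
by rewrite opprB addrA subrK.
Qed.

Variable sol : seq lineq -> nat -> (nat -> G) -> nat -> G.

Fixpoint eval (m : G) (t : solterm) : G :=
  match t with
  | Gen => m
  | Sol es args i => sol es (size args) (nth 0 (map (eval m) args)) i
  end.

Definition value m es (args : seq solterm) := sol es (size args) (nth 0 (map (eval m) args)).

Hypothesis sol_diff : forall es n c c',
  (exists y, solution q es n (fun i => c i - c' i) y) ->
  forall i, (i < n)%N -> sol es n c i - sol es n c' i = c i - c' i.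

(** A system with constants in the set of differences is handled by the terms
    [Sol es args i] at [m] and at [m']: their difference solves it up to the
    difference of two errors, which is zero by hypothesis. *)
Lemma differences_pure m m' :
  (forall es args e, e \in es ->
     defect e (value m es args) = defect e (value m' es args)) ->
  locally_pure q (fun x => exists t, x = eval m t - eval m' t).
Proof.
move=> err S T; set D : G -> Prop := fun x => exists t, x = eval m t - eval m' t.
have /choice[t tE] : forall x, exists t, D x -> x = eval m t - eval m' t.
  by move=> x; have [[t tx]|nD] := EM (D x); [exists t|exists Gen => /nD].
(* The elements of [S] that are constants of the system come first in [V]. *)
pose C := [seq x <- S | `[< D x >]].
have CD x : x \in C -> D x by rewrite mem_filter => /andP[/asboolP].
pose args := map t C; pose V := C ++ S; pose v := nth 0 V.
pose I := iota 0 (size V).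
pose es : seq lineq :=
  [seq e <- [seq inl (i, jk.1, jk.2) | i <- I, jk <- [seq (j, k) | j <- I, k <- I]]
         ++ [seq inr (a, ij.1, ij.2) | a <- T, ij <- [seq (i, j) | i <- I, j <- I]]
     | q (defect e v) == 0].
have constE i : nth 0 (map (eval m) args) i - nth 0 (map (eval m') args) i = nth 0 C i.
  have [lt_iC|le_Ci] := ltnP i (size C); last first.
    by rewrite !nth_default ?size_map ?subr0.
  rewrite !(nth_map Gen) ?size_map // !(nth_map 0) //; symmetry; apply: tE.
  exact/CD/mem_nth.
have sargs : size args = size C by rewrite size_map.
have [vC ves] : solution q es (size args) (nth 0 C) v.
  split=> [i|e]; first by rewrite sargs /v nth_cat => ->.
  by rewrite mem_filter => /andP[/eqP].
pose y i := value m es args i - value m' es args i.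
have yC i : (i < size C)%N -> y i = nth 0 C i.
  rewrite -sargs => lt_i; rewrite -constE; apply: sol_diff => //.
  by exists v; split=> // j lt_j; rewrite constE; exact: vC.
have yes e : e \in es -> defect e y = 0 by move=> ein; rewrite defectB err ?subrr.
have memV x : x \in S -> (index x V \in I) /\ v (index x V) = x.
  move=> xS; have xV : x \in V by rewrite mem_cat xS orbT.
  by rewrite mem_iota /= index_mem /v nth_index.
exists (fun x => y (index x V)); split.
- by move=> x _; exists (Sol es args (index x V)).
- move=> x xS Dx; have xC : x \in C by rewrite mem_filter xS andbT; apply/asboolP.
  by rewrite index_cat xC yC ?index_mem // nth_index.
- move=> x x' z /memV[xI xE] /memV[x'I x'E] /memV[zI zE] qz; apply/eqP.
  rewrite -subr_eq0; apply/eqP.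
  apply: (yes (inl (index x V, index x' V, index z V))).
  rewrite mem_filter /= xE x'E zE linearB qz subrr eqxx mem_cat; apply/orP; left.
  apply/allpairsPdep; exists (index x V), (index x' V, index z V); split=> //.
  by apply/allpairsPdep; exists (index x' V), (index z V).
- move=> a x z aT /memV[xI xE] /memV[zI zE] qz; apply/eqP.
  rewrite -subr_eq0; apply/eqP; apply: (yes (inr (a, index x V, index z V))).
  rewrite mem_filter /= xE zE linearB qz subrr eqxx mem_cat; apply/orP; right.
  apply/allpairsPdep; exists a, (index x V, index z V); split=> //.
  by apply/allpairsPdep; exists (index x V), (index z V).
Qed.

End Differences.

(** If [G] has no nonzero locally pure [D] inside [ker p], then [G] is no larger
    than a set that depends on [R], [N] and [M] only. Indeed an element [m] is
    determined by the images in [M] of the elements named by all terms starting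
    from [m], and by the errors in [N] with which their equations hold: if [m]
    and [m'] share these data, the differences form a locally pure subset of
    [ker p] that contains [m - m']. *)
Lemma reduced_inj (N G A M : lmodType R) (i : {linear N -> G}) (q : {linear G -> A})
    (p : {linear G -> M}) : short_exact i q ->
  (forall D, locally_pure q D -> (forall x, D x -> p x = 0) -> forall x, D x -> x = 0) ->
  exists f : G -> (solterm -> M) * (seq lineq * seq solterm * lineq -> N), injective f.
Proof.
move=> [inj_i mid _] red; have [sol [solP sol_diff]] := exists_solver q.
have /choice[j jE] : forall x : G, exists n, q x = 0 -> i n = x.
  move=> x; have [/mid[n nE]|qx] := EM (q x = 0); first by exists n.
  by exists 0 => /qx.
(* Equations that are not part of the system carry no information. *)
exists (fun m => (fun t => p (eval sol m t), fun a =>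
  if a.2 \in a.1.1 then j (defect a.2 (value sol m a.1.1 a.1.2)) else 0)).
move=> m m' [/(congr1 (fun f => f _)) pmm' err].
have {}err es args e : e \in es ->
    defect e (value sol m es args) = defect e (value sol m' es args).
  move=> ein; have := congr1 (fun f => i (f (es, args, e))) err.
  by rewrite /= ein !jE // solP.
have := red _ (differences_pure sol_diff err).
move=> h; apply/eqP; rewrite -subr_eq0; apply/eqP; apply: h; last by exists Gen.
by move=> _ [t ->]; rewrite linearB (pmm' t) subrr.
Qed.

End Bound.

(** * Permanence of local purity *)
Section LocallyPureTheory.
Variables (R : pzRingType) (G A : lmodType R) (q : {linear G -> A}).

Lemma locally_pure_eq (D E : G -> Prop) :
  (forall x, D x <-> E x) -> locally_pure q D -> locally_pure q E.
Proof. by move=> DE; have -> : E = D by apply/predeqP => x; split=> /DE. Qed.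

Lemma locally_pure0 : locally_pure q (fun x => x = 0).
Proof.
move=> S T; exists (fun=> 0); split=> // [x y z _ _ _ _|a x y _ _ _ _]; first exact: addr0.
exact: scaler0.
Qed.

Lemma locally_pure_disjoint D x : locally_pure q D -> D x -> q x = 0 -> x = 0.
Proof.
move=> pure Dx qx; have [s [_ sfix sD _]] := pure [:: x; 0] [::].
have xS : x \in [:: x; 0] by rewrite inE eqxx.
have zS : 0 \in [:: x; 0] by rewrite !inE eqxx orbT.
rewrite -(sfix x) //; apply: (@addIr _ (s 0)); rewrite add0r; apply: sD => //.
by rewrite addr0 qx linear0.
Qed.

(** The tested relations include those that express closure under the operations. *)
Lemma locally_pure_submod D : locally_pure q D ->
  exists P : submod G, forall x, P x <-> D x.
Proof.
move=> pure; unshelve eexists (@Submod R G D _) => //; split=> [|x y Dx Dy|a x Dx].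
- have [s [sin _ sD _]] := pure [:: 0] [::].
  have zS : 0 \in [:: 0 : G] by rewrite inE.
  have := sin 0 zS; suff -> : s 0 = 0 by [].
  by apply: (@addrI _ (s 0)); rewrite addr0; apply: sD => //; rewrite addr0.
- have [s [sin sfix sD _]] := pure [:: x; y; x + y] [::].
  have [xS yS zS] : [/\ x \in [:: x; y; x + y], y \in [:: x; y; x + y]
    & x + y \in [:: x; y; x + y]] by rewrite !inE !eqxx !orbT.
  rewrite -(sfix x xS Dx) -(sfix y yS Dy) (sD x y _ xS yS zS erefl); exact: sin.
- have [s [sin sfix _ sZ]] := pure [:: x; a *: x] [:: a].
  have [xS yS] : x \in [:: x; a *: x] /\ a *: x \in [:: x; a *: x].
    by rewrite !inE !eqxx orbT.
  rewrite -(sfix x xS Dx) (sZ a x (a *: x)) ?inE ?eqxx ?orbT //; exact: sin.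
Qed.

Lemma locally_pure_image D : (forall y, exists x, q x = y) -> locally_pure q D ->
  locally_pure (idfun : {linear A -> A}) (fun y => exists2 x, D x & q x = y).
Proof.
move=> surj pure S T.
have /choice[l lP] : forall y, exists x, q x = y /\ ((exists2 x, D x & q x = y) -> D x).
  move=> y; have [[x Dx xy]|nD] := EM (exists2 x, D x & q x = y); first by exists x.
  by have [x xy] := surj y; exists x; split=> // /nD.
have [s [sin sfix sD sZ]] := pure (map l S) T.
exists (fun y => q (s (l y))); split=> [y yS|y yS Dy|x y z xS yS zS /= xyz|a x y aT xS yS /= xy].
- by exists (s (l y)) => //; apply/sin/map_f.
- by rewrite sfix ?(lP y).1 ?map_f //; apply: (lP y).2.
- rewrite -xyz -linearD; congr (q _); apply: sD; [exact: map_f|exact: map_f| |].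
    by rewrite xyz; exact: map_f.
  by rewrite linearD !(lP _).1.
- rewrite -xy -linearZ; congr (q _); apply: sZ; [done|exact: map_f|by rewrite xy; exact: map_f|].
  by rewrite linearZ /= !(lP _).1.
Qed.

(** Purity of an increasing union: only finitely many elements are tested. *)
Lemma locally_pure_bigcup (C : set (set G)) : total_on C subset ->
  (forall D, C D -> locally_pure q (fun x => D x \/ x = 0)) ->
  locally_pure q (fun x => (\bigcup_(D in C) D)%classic x \/ x = 0).
Proof.
move=> tot pureC S T.
have [D [CD0 SD]] : exists D : set G, (C D \/ D = set0) /\
    forall x, x \in S -> (\bigcup_(D in C) D)%classic x -> D x.
  elim: S => [|x S [D [CD SD]]]; first by exists set0; split; [right|].
  have [[E CE Ex]|nx] := EM ((\bigcup_(D in C) D)%classic x); last first.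
    exists D; split=> // y; rewrite inE => /orP[/eqP -> /nx //|]; exact: SD.
  have [DE|ED] : (D `<=` E)%classic \/ (E `<=` D)%classic.
    by case: CD => [CD|->]; [exact: tot|left].
  - exists E; split=> [|y]; first by left.
    rewrite inE => /orP[/eqP -> //|yS Cy]; exact/DE/SD.
  - exists D; split=> // y; rewrite inE => /orP[/eqP -> _|]; [exact: ED|exact: SD].
have pureD : locally_pure q (fun x => D x \/ x = 0).
  case: CD0 => [/pureC //|->]; apply: locally_pure_eq locally_pure0 => x.
  by split=> [|[]//]; right.
have [s [sin sfix sD sZ]] := pureD S T.
exists s; split=> // [x xS|x xS [Cx|x0]]; last by apply: sfix => //; right.
  have [Dx|] := sin x xS; last by right.
  left; case: CD0 => [CD|D0]; first by exists D.
  by rewrite D0 in Dx.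
by apply: sfix => //; left; apply: SD.
Qed.

End LocallyPureTheory.

(** Transitivity of purity. A first retraction, lifted along [p], respects the
    relations up to errors [dD] and [dZ] in [ker p]; the vectors [v x = x - t x]
    show that these errors can be compensated modulo [ker q], hence also inside
    [ker p], by the second retraction. *)
Lemma locally_pure_trans (R : pzRingType) (G A G' A' : lmodType R) (q : {linear G -> A})
    (q' : {linear G' -> A'}) (p : {linear G -> G'}) (D' : G' -> Prop) :
  (forall y, exists x, p x = y) -> (forall x, q x = 0 -> q' (p x) = 0) ->
  locally_pure q (fun x => p x = 0) -> locally_pure q' D' ->
  locally_pure q (fun x => D' (p x)).
Proof.
move=> /choice[l lP] qq' pure pure' S T.
have qq'E x y : q x = q y -> q' (p x) = q' (p y).
  by move=> xy; apply/ker_eq; rewrite -linearB; apply/qq'/ker_eq.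
have [s [sin sfix sD sZ]] := pure' (map p S) T.
pose t x := if `[< D' (p x) >] then x else l (s (p x)).
have pt x : x \in S -> p (t x) = s (p x).
  rewrite /t; case: asboolP => [Dx xS|_ _]; last exact: lP.
  by rewrite sfix ?map_f.
pose v x := x - t x.
pose dD c := t c.1.1 + t c.1.2 - t c.2.
pose dZ c := c.1.1 *: t c.1.2 - t c.2.
pose S2 := [:: 0] ++ map v S ++ [seq v x + v y | x <- S, y <- S] ++
  [seq dD (xy, z) | xy <- [seq (x, y) | x <- S, y <- S], z <- S] ++
  [seq a *: v x | a <- T, x <- S] ++
  [seq dZ (ax, y) | ax <- [seq (a, x) | a <- T, x <- S], y <- S].
have [r [rin rfix rD rZ]] := pure S2 T.
have S0 : 0 \in S2 by rewrite !mem_cat mem_head.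
have Sv x : x \in S -> v x \in S2.
  by move=> xS; rewrite !mem_cat map_f ?orbT.
have SvD x y : x \in S -> y \in S -> v x + v y \in S2.
  move=> xS yS; have h := allpairs_f (fun x y => v x + v y) xS yS.
  by rewrite !mem_cat h !orbT.
have SdD x y z : x \in S -> y \in S -> z \in S -> dD (x, y, z) \in S2.
  move=> xS yS zS; have h := allpairs_f (fun x y => (x, y)) xS yS.
  by rewrite !mem_cat (allpairs_f (fun xy z => dD (xy, z)) h zS) !orbT.
have SvZ a x : a \in T -> x \in S -> a *: v x \in S2.
  by move=> aT xS; rewrite !mem_cat (allpairs_f (fun a x => a *: v x) aT xS) !orbT.
have SdZ a x y : a \in T -> x \in S -> y \in S -> dZ (a, x, y) \in S2.
  move=> aT xS yS; have h := allpairs_f (fun a x => (a, x)) aT xS.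
  by rewrite !mem_cat (allpairs_f (fun ax y => dZ (ax, y)) h yS) !orbT.
have r0 : r 0 = 0 by apply: rfix => //; exact: linear0.
exists (fun x => t x + r (v x)); split.
- by move=> x xS; rewrite linearD (rin _ (Sv x xS)) addr0 pt //; apply/sin/map_f.
- move=> x xS Dx; have tx : t x = x by rewrite /t; case: asboolP.
  by rewrite /v tx subrr r0 addr0.
- move=> x y z xS yS zS qz.
  have rd : r (dD (x, y, z)) = dD (x, y, z).
    apply: rfix; [exact: SdD|]; rewrite linearB linearD /= !pt //.
    apply/eqP; rewrite subr_eq0; apply/eqP/sD; rewrite ?map_f //.
    by rewrite -linearD; exact: qq'E.
  have <- : r (v x + v y) + r (dD (x, y, z)) = r (v z).
    apply: rD; [exact: SvD|exact: SdD|exact: Sv|].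
    rewrite /v /dD /= (addrACA x) -opprD addrA subrK.
    by rewrite linearB qz -linearB.
  rewrite -(rD (v x) (v y) (v x + v y)) ?Sv ?SvD // rd /dD /=.
  by rewrite addrACA [RHS]addrC -[RHS]addrA subrK addrC.
- move=> a x y aT xS yS qy.
  have rd : r (dZ (a, x, y)) = dZ (a, x, y).
    apply: rfix; [exact: SdZ|]; rewrite linearB linearZ /= !pt //.
    apply/eqP; rewrite subr_eq0; apply/eqP/sZ; rewrite ?map_f //.
    by rewrite -linearZ; exact: qq'E.
  have <- : r (a *: v x) + r (dZ (a, x, y)) = r (v y).
    apply: rD; [exact: SvZ|exact: SdZ|exact: Sv|].
    by rewrite /v /dZ /= scalerBr addrA subrK linearB qy -linearB.
  rewrite -(rZ a (v x) (a *: v x)) ?Sv ?SvZ // rd /dZ /=.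
  by rewrite scalerDr [RHS]addrC -[RHS]addrA subrK addrC.
Qed.

(** * Directed colimits *)
Section Colimit.
Variables (R : pzRingType) (J : Type) (le : J -> J -> Prop).
Hypotheses (le_refl : forall j, le j j)
  (le_trans : forall i j k, le i j -> le j k -> le i k)
  (le_total : forall i j, le i j \/ le j i).

Definition eventually (P : J -> Prop) := exists j0, forall j, le j0 j -> P j.

Lemma eventually_and P Q :
  eventually P -> eventually Q -> eventually (fun j => P j /\ Q j).
Proof.
move=> [j hP] [k hQ]; have [jk|kj] := le_total j k.
- by exists k => l kl; split; [apply/hP/(le_trans jk)|apply: hQ].
- by exists j => l jl; split; [apply: hP|apply/hQ/(le_trans kj)].
Qed.

Lemma eventually_impl (P Q : J -> Prop) :
  (forall j, P j -> Q j) -> eventually P -> eventually Q.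
Proof. by move=> PQ [j hP]; exists j => k /hP/PQ. Qed.

Variables (X : J -> lmodType R) (d : forall i j, X i -> X j).
Arguments d : clear implicits.
Hypotheses (d_linear : forall i j, le i j -> linear (d i j))
  (d_comp : forall i j k x, le i j -> le j k -> d j k (d i j x) = d i k x).

(** The colimit is the quotient of the direct sum by the elements that vanish at
    all late stages. This kernel is pure: once [j] is late enough for finitely
    many elements [s], the linear map taking [s] to [s] minus its total at
    stage [j] retracts them into the kernel. So [F] is closed under directed
    colimits. *)
Lemma colimit (j0 : J) : exists (C : lmodType R) (c : forall j, {linear X j -> C}),
  [/\ forall j k x, le j k -> c k (d j k x) = c j x,
      forall y, exists j x, c j x = y,
      forall j x, c j x = 0 -> exists2 k, le j k & d j k x = 0,
      forall (Y : lmodType R) (f : forall j, {linear X j -> Y}),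
        (forall j k x, le j k -> f k (d j k x) = f j x) ->
        exists g : {linear C -> Y}, forall j x, g (c j x) = f j x
    & forall F : lmodType R -> Prop, closed_dsum F -> closed_pure_quotient F ->
        (forall j, F (X j)) -> F C].
Proof.
have d0 i j : le i j -> d i j 0 = 0.
  by move=> /d_linear/lin_of[g gE]; rewrite -gE linear0.
have dD i j x y : le i j -> d i j (x + y) = d i j x + d i j y.
  by move=> /d_linear/lin_of[g gE]; rewrite -!gE linearD.
have ex_phi i j : exists g : {linear X i -> X j}, le i j -> forall x, g x = d i j x.
  have [/d_linear/lin_of[g gE]|nle] := EM (le i j); first by exists g.
  by exists \0 => /nle.
pose phi j i := sval (cid (ex_phi i j)).
pose t j := sval (cid (dsum_lift (phi j))).
have tE i j x : le i j -> t j (dsum_in X i x) = d i j x.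
  by move=> ij; rewrite (svalP (cid (dsum_lift (phi j)))) (svalP (cid (ex_phi i j))).
have stable s : eventually (fun j => forall k, le j k -> t k s = d j k (t j s)).
  elim/dsum_ind: s => [|x y hx hy|i x].
  - by exists j0 => j _ k jk; rewrite !linear0 d0.
  - apply: eventually_impl (eventually_and hx hy) => j [hjx hjy] k jk.
    by rewrite !linearD dD // hjx // hjy.
  - exists i => j ij k jk; rewrite !tE ?d_comp //; exact: le_trans ij jk.
pose null s := eventually (fun j => t j s = 0).
have [K KE] : exists K : submod (dsum X), forall s, K s <-> null s.
  unshelve eexists (@Submod R _ null _) => //; split=> [|x y hx hy|a x hx].
  - by exists j0 => j _; exact: linear0.
  - apply: eventually_impl (eventually_and hx hy) => j [xj yj].
    by rewrite linearD xj yj addr0.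
  - by apply: eventually_impl hx => j xj; rewrite linearZ /= xj scaler0.
have [C [p [p_surj pE]]] := quotient K.
exists C, (fun j => p \o dsum_in X j : {linear X j -> C}).
split=> [j k x jk|y|j x|Y f fd|F Fsum Fpure FX].
- rewrite /=; apply/ker_eq/pE/KE; exists k => l kl.
  by rewrite linearB !tE ?d_comp ?subrr //; exact: le_trans jk kl.
- have [s <-] := p_surj y; have [j /(_ j (le_refl j)) hj] := stable s.
  exists j, (t j s); rewrite /=; apply/esym/ker_eq/pE/KE; exists j => k jk.
  by rewrite linearB tE // (hj k jk) subrr.
- rewrite /= => /pE/KE[k hk]; have [kj|jk] := le_total k j.
    by exists j => //; rewrite -tE ?hk.
  by exists k => //; rewrite -tE ?hk.
- have [h hE] := dsum_lift f.
  have h_stable s : eventually (fun j => h s = f j (t j s)).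
    elim/dsum_ind: s => [|x y hx hy|i x].
    + by exists j0 => j _; rewrite !linear0.
    + apply: eventually_impl (eventually_and hx hy) => j [xj yj].
      by rewrite !linearD xj yj.
    + by exists i => j ij; rewrite hE tE // fd.
  have [g gE] : exists g : {linear C -> Y}, forall s, g (p s) = h s.
    apply: factor_surj => // s /pE/KE s0.
    have [j hj] := eventually_and s0 (h_stable s).
    by have [tj ->] := hj j (le_refl j); rewrite tj linear0.
  by exists g => j x; rewrite /= gE hE.
- apply: (local_pure_quotient Fpure p_surj) (Fsum _ _ FX) => S T.
  have [j hj] : eventually (fun j => forall s, s \in S ->
      (forall k, le j k -> t k s = d j k (t j s)) /\ (null s -> t j s = 0)).
    elim: S => [|s S IH]; first by exists j0.
    have s0 : eventually (fun j => null s -> t j s = 0).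
      have [[k hk]|nn] := EM (null s); first by exists k => l /hk.
      by exists j0 => j _ /nn.
    apply: eventually_impl (eventually_and IH (eventually_and (stable s) s0)).
    by move=> j [hS [st n0]] u; rewrite inE => /orP[/eqP ->|/hS].
  have {}hj := hj j (le_refl j).
  have [u uE] : exists u : {linear dsum X -> dsum X}, forall s, u s = dsum_in X j (t j s).
    by exists (dsum_in X j \o t j).
  exists (fun s => s - u s); split=> [s sS|s sS /pE/KE s0|x y z _ _ _ /= <-|a x y _ _ _ /= <-].
  + apply/pE/KE; exists j => k jk; have [st _] := hj s sS.
    by rewrite linearB uE tE // -st // subrr.
  + by have [_ n0] := hj s sS; rewrite uE n0 // linear0 subr0.
  + by rewrite (linearD u) opprD addrACA.
  + by rewrite (linearZ_LR u) -scalerBr.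
Qed.

End Colimit.

(** * Factorizations with cokernel in [F] *)
Section Factorizations.
Variables (R : pzRingType) (F : lmodType R -> Prop).
Hypothesis F_pure : closed_pure_quotient F.
Variables (N M : lmodType R) (theta : {linear N -> M}).

(** For [N = 0] this is a module of [F] over [M]; for [M = 0], an extension of a
    module of [F] by [N]. *)
Record factorization := Factorization { fact_mid :> lmodType R; fact_coker : lmodType R;
  fact_in : {linear N -> fact_mid}; fact_proj : {linear fact_mid -> fact_coker};
  fact_out : {linear fact_mid -> M};
  fact_exact : short_exact fact_in fact_proj; fact_F : F fact_coker;
  fact_comm : forall n, fact_out (fact_in n) = theta n }.

Definition fact_mor (X Y : factorization) (f : X -> Y) :=
  [/\ linear f, forall n, f (fact_in X n) = fact_in Y n
    & forall x, fact_out Y (f x) = fact_out X x].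

Lemma fact_mor_id (X : factorization) : fact_mor (X := X) id. Proof. by []. Qed.

Lemma fact_mor_comp (X Y Z : factorization) (f : X -> Y) (g : Y -> Z) :
  fact_mor f -> fact_mor g -> fact_mor (g \o f).
Proof.
move=> [lf fi fo] [lg gi go]; split=> [a x y|n|x] /=; first by rewrite lf lg.
- by rewrite fi gi.
- by rewrite go fo.
Qed.

Definition reduced (X : factorization) := forall D : X -> Prop,
  locally_pure (fact_proj X) D -> (forall x, D x -> fact_out X x = 0) -> forall x, D x -> x = 0.

(** Divide by a maximal locally pure subset of the kernel of the map to [M]. *)
Lemma reduce (X : factorization) : exists (Y : factorization) (f : X -> Y), reduced Y /\ fact_mor f.
Proof.
case: X => G A i q p ex FA comm /=; have [inj_i mid_iq surj] := ex.
(* The union of the empty chain is empty, hence the alternative [x = 0]. *)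
pose ok (D : set G) := locally_pure q (fun x => D x \/ x = 0) /\
  forall x, D x -> p x = 0.
have [D0 [[pure0 p0] max0]] : exists D, ok D /\ forall B, (D `<` B)%classic -> ~ ok B.
  apply: Zorn_bigcup => C Cok totC; split.
    by apply: locally_pure_bigcup => // D /Cok[].
  by move=> x [D /Cok[_ h] /h].
have [P PE] := locally_pure_submod pure0.
have pP x : P x -> p x = 0.
  by move=> /PE[/p0 //|->]; exact: linear0.
have disj x : P x -> q x = 0 -> x = 0 by move=> /PE Px; exact: locally_pure_disjoint pure0 Px.
have [G' [r [r_surj rE]]] := quotient P.
have [Q QE] : exists Q : submod A, forall y, Q y <-> exists2 x, P x & q x = y.
  unshelve eexists (@Submod R A (fun y => exists2 x, P x & q x = y) _) => //.
  split=> [|_ _ [x Px <-] [y Py <-]|a _ [x Px <-]].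
  - by exists 0; [exact: submod0|exact: linear0].
  - by exists (x + y); [exact: submodD|exact: linearD].
  - by exists (a *: x); [exact: submodZ|exact: linearZ].
have [A' [rA [rA_surj rAE]]] := quotient Q.
have [q' q'E] : exists q' : {linear G' -> A'}, forall x, q' (r x) = rA (q x).
  apply: (factor_surj (f := rA \o q)) => // x /rE Px /=.
  by apply/rAE/QE; exists x.
have [p' p'E] : exists p' : {linear G' -> M}, forall x, p' (r x) = p x.
  by apply: factor_surj => // x /rE/pP.
have ex' : short_exact (r \o i) q'.
  split=> [|y|y].
  - apply: (raddf_inj (f := r \o i)) => n /= /rE Pn; apply/inj_i; rewrite linear0.
    by apply: disj => //; apply/mid_iq; exists n.
  - have [x <-] := r_surj y; rewrite q'E; split=> [/rAE/QE[z Pz qz]|[n /= nE]].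
      have /mid_iq[n nE] : q (x - z) = 0 by rewrite linearB qz subrr.
      by exists n; rewrite /= nE linearB (rE z).2 // subr0.
    by rewrite -q'E -nE q'E (mid_iq _).2 ?linear0 //; exists n.
  - have [a <-] := rA_surj y; have [x <-] := surj a.
    by exists (r x); rewrite q'E.
have FA' : F A'.
  apply: (local_pure_quotient F_pure rA_surj) FA.
  apply: locally_pure_eq (locally_pure_image surj pure0) => y; split.
    by move=> [x /PE Px qx]; apply/rAE/QE; exists x.
  by move=> /rAE/QE[x /PE Px qx]; exists x.
have comm' n : p' ((r \o i) n) = theta n by rewrite /= p'E.
exists (Factorization ex' FA' comm'), r; split; last by split=> // a x y; exact: linearP.
move=> D /= pureD pD x Dx; have [z zx] := r_surj x.
pose B := [set z | D (r z)]%classic.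
have BP : (B `<=` P)%classic.
  have D0B : (D0 `<=` B)%classic.
    move=> u D0u; have [E EE] := locally_pure_submod pureD.
    rewrite /B /=; have -> : r u = 0 by apply/rE/PE; left.
    by apply/EE; exact: submod0.
  have okB : ok B.
    split=> [|u /pD]; last by rewrite p'E.
    have : locally_pure q (fun u => D (r u)).
      apply: (locally_pure_trans (q' := q')) => // [u qu|].
        by rewrite q'E qu linear0.
      by apply: locally_pure_eq pure0 => u; rewrite -PE; split=> /rE.
    move=> pureB; have [E EE] := locally_pure_submod pureB.
    apply: locally_pure_eq pureB => u; split=> [|[//|->]]; first by left.
    by apply/EE; exact: submod0.
  move=> u Bu; apply/PE; left; apply: contrapT => nu.
  by apply: (max0 B) => //; split=> // /(_ u Bu).
by rewrite -zx; apply/rE/BP; rewrite /B /= zx.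
Qed.

End Factorizations.

(** * Weakly terminal factorizations *)
Section WeaklyTerminal.
Variables (R : pzRingType) (F : lmodType R -> Prop).
Hypotheses (F_dsum : closed_dsum F) (F_pure : closed_pure_quotient F).
Variables (N M : lmodType R) (theta : {linear N -> M}).
Notation factorization := (factorization F theta).

(** The sum of the [X j] amalgamated over [N]: the copies of [N] in the [X j] are
    identified with one more copy, indexed by [None], so that the cokernel is
    the direct sum of the cokernels. *)
Lemma amalgam (J : Type) (X : J -> factorization) :
  exists Y : factorization, forall j, exists f : X j -> Y, fact_mor f.
Proof.
pose Z (o : option J) : lmodType R := if o is Some j then fact_mid (X j) else N.
pose A j := fact_coker (X j).
have [Q QE] : exists Q : {linear dsum Z -> dsum A},
    (forall j (x : X j), Q (dsum_in Z (Some j) x) = dsum_in A j (fact_proj (X j) x)) /\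
    forall n, Q (dsum_in Z None n) = 0.
  pose phi o : {linear Z o -> dsum A} :=
    match o with Some j => dsum_in A j \o fact_proj (X j) | None => \0 end.
  have [Q QE] := dsum_lift phi.
  by exists Q; split=> [j x|n]; [exact: (QE (Some j))|exact: (QE None)].
have [P PE] : exists P : {linear dsum Z -> M},
    (forall j (x : X j), P (dsum_in Z (Some j) x) = fact_out (X j) x) /\
    forall n, P (dsum_in Z None n) = theta n.
  pose phi o : {linear Z o -> M} :=
    match o with Some j => fact_out (X j) | None => theta end.
  have [P PE] := dsum_lift phi.
  by exists P; split=> [j x|n]; [exact: (PE (Some j))|exact: (PE None)].
pose B (j : J) := N.
have [rho rhoE] : exists rho : {linear dsum B -> dsum Z}, forall j n,
    rho (dsum_in B j n) = dsum_in Z (Some j) (fact_in (X j) n) - dsum_in Z None n.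
  pose u j : {linear B j -> dsum Z} := dsum_in Z (Some j) \o fact_in (X j).
  pose v : {linear Z None -> dsum Z} := dsum_in Z None.
  by have [rho rhoE] := dsum_lift (fun j => u j \- v : {linear B j -> dsum Z}); exists rho.
have [K KE] := range_submod rho; have [Y [p [p_surj pE]]] := quotient K.
have pN j n : p (dsum_in Z (Some j) (fact_in (X j) n)) = p (dsum_in Z None n).
  by apply/ker_eq/pE/KE; exists (dsum_in B j n).
have comp_rho s j : rho s (Some j) = fact_in (X j) (s j).
  elim/dsum_ind: s => [|x y hx hy|k n].
  - by rewrite linear0 [RHS]linear0.
  - by rewrite (linearD rho) !dsumDE hx hy linearD.
  - rewrite rhoE dsumDE.
    have -> : (- dsum_in Z None n) (Some j) = 0.
      by rewrite -scaleN1r dsumZE dsum_in_neq // scaler0.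
    rewrite addr0; have [e|ne] := EM (k = j).
      by case: _ / e; rewrite !dsum_in_id.
    by rewrite !dsum_in_neq ?linear0 // => -[].
have [q qE] : exists q : {linear Y -> dsum A}, forall x, q (p x) = Q x.
  apply: factor_surj => // x /pE/KE[s <-]; elim/dsum_ind: s => [|y z hy hz|j n].
  - by rewrite !linear0.
  - by rewrite !linearD hy hz addr0.
  - have [_ mid_j _] := fact_exact (X j).
    have qi0 : fact_proj (X j) (fact_in (X j) n) = 0 by apply/mid_j; exists n.
    by rewrite rhoE linearB QE.1 QE.2 qi0 linear0 subr0.
have [r rE] : exists r : {linear Y -> M}, forall x, r (p x) = P x.
  apply: factor_surj => // x /pE/KE[s <-]; elim/dsum_ind: s => [|y z hy hz|j n].
  - by rewrite !linear0.
  - by rewrite !linearD hy hz addr0.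
  - by rewrite rhoE linearB PE.1 PE.2 fact_comm subrr.
pose i : {linear N -> Y} := p \o (dsum_in Z None : {linear Z None -> dsum Z}).
have ex : short_exact i q.
  split=> [|y|y].
  - apply: raddf_inj => n /= /pE/KE[s sn].
    have s0 : s = 0.
      apply: dsumP => j; have [inj_j _ _] := fact_exact (X j).
      by apply: inj_j; rewrite -comp_rho sn dsum_in_neq // [RHS]linear0.
    by rewrite -(dsum_in_id (i := None : option J) (D := Z) n) -sn s0 linear0.
  - split=> [|[n <-]]; last by rewrite /i /= qE QE.2.
    (* The maps [A j -> L = Y / N] show that [Q x] determines [x] modulo [N]. *)
    have [I IE] := range_submod i; have [L [l [_ lE]]] := quotient I.
    have ex_g j : exists g : {linear A j -> L},
        forall x, g (fact_proj (X j) x) = l (p (dsum_in Z (Some j) x)).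
      have [_ mid_j surj_j] := fact_exact (X j).
      apply: (factor_surj (f := l \o p \o dsum_in Z (Some j))) => // x /mid_j[n <-].
      by apply/lE/IE; exists n; rewrite /= -(pN j).
    have [g gE] := dsum_lift (fun j => sval (cid (ex_g j))).
    have gQ x : g (Q x) = l (p x).
      move: x; apply: (dsum_eq (f := g \o Q) (g := l \o p)) => -[j|] x /=.
        by rewrite QE.1 gE (svalP (cid (ex_g j))).
      by rewrite QE.2 linear0; apply/esym/lE/IE; exists x.
    have [x <-] := p_surj y; rewrite qE => Qx.
    by apply/IE/lE; rewrite -gQ Qx linear0.
  - elim/dsum_ind: y => [|x y [u <-] [v <-]|j a].
    + by exists 0; rewrite linear0.
    + by exists (u + v); rewrite linearD.
    + have [_ _ /(_ a)[x <-]] := fact_exact (X j).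
      by exists (p (dsum_in Z (Some j) x)); rewrite qE QE.1.
have FA : F (dsum A) by apply: F_dsum => j; exact: fact_F.
have comm n : r (i n) = theta n by rewrite /i /= rE PE.2.
exists (Factorization ex FA comm) => j.
pose f : {linear Z (Some j) -> Y} := p \o dsum_in Z (Some j).
exists f; split=> [|n|x] /=; first exact: (linearP f).
- exact: pN.
- by rewrite rE PE.1.
Qed.

Definition weakly_terminal (T : factorization) :=
  forall X : factorization, exists f : X -> T, fact_mor f.

(** By [reduce] and [reduced_inj] every factorization maps to one that is a
    quotient of the free module [P] on a fixed set. Up to isomorphism such a
    quotient is described by its [shape], a datum on [P], and the shapes form a
    set over which one can amalgamate. *)
Lemma exists_weakly_terminal : exists T, weakly_terminal T.
Proof.
pose V := {classic (solterm R -> M) * (seq (lineq R) * seq (solterm R) * lineq R -> N)}.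
pose P := freemod R V.
pose shape := ((P -> Prop) * (N * P -> Prop) * (P -> M))%type.
pose realizes (a : shape) (X : factorization) (e : {linear P -> X}) :=
  [/\ forall z, a.1.1 z <-> e z = 0, forall n z, a.1.2 (n, z) <-> fact_in X n = e z
    & forall z, a.2 z = fact_out X (e z)].
pose J := {a : shape | exists (X : factorization) (e : {linear P -> X}), realizes a X e}.
pose X (j : J) := sval (cid (svalP j)).
have [T hT] := amalgam X; exists T => G.
have [H [f [redH fm]]] := reduce F_pure G.
have [key key_inj] := reduced_inj (fact_exact H) redH.
have /choice[s sE] : forall v : V, exists x, forall y, key y = v -> x = y.
  move=> v; have [[y yv]|nv] := EM (exists y, key y = v).
    by exists y => z zv; apply: key_inj; rewrite yv zv.
  by exists 0 => y yv; case: nv; exists y.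
pose e : {linear P -> H} := freelift s.
have e_surj y : exists z, e z = y.
  by apply: freemod_surj => x; exists (key x); apply: sE.
pose a : shape := (fun z => e z = 0, fun nz => fact_in H nz.1 = e nz.2, fun z => fact_out H (e z)).
have aP : exists (X : factorization) (e : {linear P -> X}), realizes a X e by exists H, e.
pose j : J := exist _ a aP.
have [e' [ker_e' fin_e' fout_e']] := svalP (cid (svalP j)).
have [g gE] : exists g : {linear H -> X j}, forall z, g (e z) = e' z.
  by apply: factor_surj => // z /ker_e'.
have gm : fact_mor (g : H -> X j).
  split=> [|n|x]; first exact: linearP.
    by have [z zn] := e_surj (fact_in H n); rewrite -zn gE; apply/esym/fin_e'.
  by have [z <-] := e_surj x; rewrite gE -fout_e'.
have [h hm] := hT j.
exists (h \o (g : H -> X j) \o f); apply: fact_mor_comp fm _; exact: fact_mor_comp gm hm.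
Qed.

End WeaklyTerminal.

(** * Well-orders and Cantor's diagonal *)
Lemma exists_well_order (I : Type) : exists lt : I -> I -> Prop,
  [/\ well_founded lt, forall i j k, lt i j -> lt j k -> lt i k
    & forall i j, [\/ i = j, lt i j | lt j i]].
Proof.
have [le wo] := wochoice.well_ordering_principle {classic I}.
have min_of (A : {pred {classic I}}) a : a \in A ->
    exists2 m, m \in A & forall b, b \in A -> le m b.
  by move=> aA; have [|m [[mA mle] _]] := wo A; [exists a|exists m].
have refl a : le a a.
  have [|m mA h] := min_of (pred1 a) a; first exact: eqxx.
  by move: (eqP mA) h => -> /(_ a)/(_ (eqxx a)).
have anti a b : le a b -> le b a -> a = b.
  move=> ab ba; have [|m [_ uniq]] := wo (pred2 a b); first by exists a; rewrite inE eqxx.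
  apply: etrans (esym (uniq a _)) (uniq b _); split; rewrite ?inE ?eqxx ?orbT // => c;
    by rewrite !inE => /orP[]/eqP ->.
have total a b : le a b \/ le b a.
  have [|m mA h] := min_of (pred2 a b) a; first by rewrite inE eqxx.
  move: mA h; rewrite inE => /orP[]/eqP -> h; [left|right]; by apply: h; rewrite !inE eqxx ?orbT.
have trans a b c : le a b -> le b c -> le a c.
  move=> ab bc; have [|m mA h] := min_of (pred3 a b c) a; first by rewrite inE eqxx.
  move: mA h; rewrite inE => /or3P[]/eqP -> h.
  - by apply: h; rewrite !inE eqxx !orbT.
  - by rewrite (anti a b ab) //; apply: h; rewrite !inE eqxx.
  - have cb : le c b by apply: h; rewrite !inE eqxx orbT.
    by rewrite (anti c b cb bc).
exists (fun a b : {classic I} => le a b /\ a <> b); split.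
- move=> a; apply: contrapT => na.
  pose acc := Acc (fun a b : {classic I} => le a b /\ a <> b).
  have [|m /asboolP nm h] := min_of (fun b => `[< ~ acc b >]) a; first exact/asboolP.
  apply: nm; constructor=> b [bm neq]; apply: contrapT => nb.
  by apply: neq; apply: anti => //; apply: h; apply/asboolP.
- move=> a b c [ab nab] [bc nbc]; split; first exact: trans ab bc.
  by move=> ac; apply: nab; apply: anti => //; rewrite ac.
- move=> a b; have [->|ne] := EM (a = b); first by constructor 1.
  have [ab|ba] := total a b; first by constructor 2.
  by constructor 3; split=> // ba'; apply: ne.
Qed.

Lemma well_founded_irreflexive (I : Type) (lt : I -> I -> Prop) :
  well_founded lt -> forall i, ~ lt i i.
Proof.
by move=> wf; elim/(well_founded_ind wf) => i IH ii; exact: (IH i ii ii).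
Qed.

Lemma cantor (T : Type) (f : (T -> Prop) -> T) : ~ injective f.
Proof.
move=> inj_f; pose D x := exists2 P : T -> Prop, f P = x & ~ P x.
have nD : ~ D (f D).
  by move=> DfD; case: (DfD) => P /inj_f -> nD; exact: nD.
by apply: (nD); exists D.
Qed.

(** * Minimality *)
Section MinimalObject.
Variables (R : pzRingType) (F : lmodType R -> Prop).
Hypotheses (F_dsum : closed_dsum F) (F_pure : closed_pure_quotient F).
Variables (N M : lmodType R) (theta : {linear N -> M}).
Notation factorization := (factorization F theta).

Lemma fact_colimit (J : Type) (le : J -> J -> Prop) (j0 : J) (X : J -> factorization)
    (d : forall i j, X i -> X j) : (forall j, le j j) ->
  (forall i j k, le i j -> le j k -> le i k) -> (forall i j, le i j \/ le j i) ->
  (forall i j, le i j -> fact_mor (d i j)) ->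
  (forall i j k x, le i j -> le j k -> d j k (d i j x) = d i k x) ->
  exists (C : factorization) (c : forall j, X j -> C), [/\ forall j, fact_mor (c j),
    forall j k x, le j k -> c k (d j k x) = c j x & forall y, exists j x, c j x = y].
Proof.
move=> le_refl le_trans le_total dm d_comp.
pose A j := fact_coker (X j).
have ex_dA i j : exists g : A i -> A j,
    le i j -> linear g /\ forall x, g (fact_proj (X i) x) = fact_proj (X j) (d i j x).
  have [ij|nle] := EM (le i j); last by exists (fun=> 0).
  have [/lin_of[f fE] fi _] := dm i j ij.
  have [_ mid_i surj_i] := fact_exact (X i); have [_ mid_j _] := fact_exact (X j).
  have [|g gE] := @factor_surj _ _ _ _ (fact_proj (X i)) (fact_proj (X j) \o f) surj_i.
    by move=> x /mid_i[n <-]; apply/mid_j; exists n; rewrite fE fi.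
  by exists g => _; split=> [|x]; [exact: linearP|rewrite gE /= fE].
pose dA i j := sval (cid (ex_dA i j)).
have dA_lin i j : le i j -> linear (dA i j) by move=> /(svalP (cid (ex_dA i j)))[].
have dAE i j x : le i j -> dA i j (fact_proj (X i) x) = fact_proj (X j) (d i j x).
  by move=> ij; exact: (svalP (cid (ex_dA i j)) ij).2.
have dA_comp i j k a : le i j -> le j k -> dA j k (dA i j a) = dA i k a.
  move=> ij jk; have [_ _ /(_ a)[x <-]] := fact_exact (X i).
  by rewrite !dAE ?d_comp //; exact: le_trans ij jk.
have d_lin i j : le i j -> linear (d i j) by case/dm.
have [G [c [c_comp c_surj c_ker c_univ _]]] :=
  colimit le_refl le_trans le_total d_lin d_comp j0.
have [B [b [b_comp b_surj b_ker _ /(_ F F_dsum F_pure) FB]]] :=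
  colimit le_refl le_trans le_total dA_lin dA_comp j0.
have [q qE] : exists q : {linear G -> B}, forall j x, q (c j x) = b j (fact_proj (X j) x).
  apply: (c_univ _ (fun j => b j \o fact_proj (X j))) => j k x jk /=.
  by rewrite -dAE // b_comp.
have [p pE] : exists p : {linear G -> M}, forall j x, p (c j x) = fact_out (X j) x.
  by apply: c_univ => j k x /dm[].
have c_fin j n : c j (fact_in (X j) n) = c j0 (fact_in (X j0) n).
  have [jj0|j0j] := le_total j j0.
    by rewrite -(c_comp _ _ _ jj0); case: (dm _ _ jj0) => _ ->.
  by rewrite -(c_comp _ _ _ j0j); case: (dm _ _ j0j) => _ ->.
have ex : short_exact (c j0 \o fact_in (X j0)) q.
  split=> [|y|a].
  - apply: raddf_inj => n /= /c_ker[k j0k]; case: (dm _ _ j0k) => _ -> _ n0.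
    have [inj_k _ _] := fact_exact (X k); apply: inj_k; by rewrite n0 linear0.
  - split=> [|[n <-]]; last first.
      have [_ mid_j0 _] := fact_exact (X j0).
      by rewrite /= qE (mid_j0 _).2 ?linear0 //; exists n.
    have [j [x <-]] := c_surj y; rewrite qE => /b_ker[k jk]; rewrite dAE //.
    have [_ mid_k _] := fact_exact (X k) => /mid_k[n nE].
    by exists n; rewrite /= -(c_fin k) nE c_comp.
  - have [j [a' <-]] := b_surj a; have [_ _ /(_ a')[x <-]] := fact_exact (X j).
    by exists (c j x).
have comm n : p ((c j0 \o fact_in (X j0)) n) = theta n by rewrite /= pE fact_comm.
exists (Factorization ex (FB (fun j => fact_F (X j))) comm), c; split=> //.
by move=> j; split=> [|n|x]; [exact: linearP|exact: c_fin|exact: pE].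
Qed.

Section Chains.
Variable T : factorization.
Hypothesis T_terminal : weakly_terminal T.

(** The colimit of a chain of copies of [T] maps back to [T], so chains of
    endomorphisms can be prolonged without leaving [T]. *)
Lemma chain_cone (J : Type) (le : J -> J -> Prop) (d : J -> J -> T -> T) :
  (forall j, le j j) -> (forall i j k, le i j -> le j k -> le i k) ->
  (forall i j, le i j \/ le j i) -> (forall i j, le i j -> fact_mor (d i j)) ->
  (forall i j k x, le i j -> le j k -> d j k (d i j x) = d i k x) ->
  exists c : J -> T -> T, (forall j, fact_mor (c j)) /\
    forall j k x, le j k -> c k (d j k x) = c j x.
Proof.
move=> le_refl le_trans le_total dm d_comp.
have [[j0 _]|nJ] := EM (exists j : J, True); last first.
  by exists (fun=> id); split=> j; case: nJ; exists j.
have [C [c [cm c_comp _]]] :=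
  @fact_colimit J le j0 (fun=> T) d le_refl le_trans le_total dm d_comp.
have [f fm] := T_terminal C; exists (fun j => f \o c j); split=> [j|j k x jk] /=.
  exact: fact_mor_comp (cm j) fm.
by rewrite c_comp.
Qed.

Variables (I : Type) (lt : I -> I -> Prop).
Hypotheses (lt_wf : well_founded lt) (lt_trans : forall i j k, lt i j -> lt j k -> lt i k)
  (lt_total : forall i j, [\/ i = j, lt i j | lt j i]).

(** The map into a stage from a bottom copy of [T] and the maps from the earlier
    stages; the second component is only meaningful at these. *)
Definition stage := ((T -> T) * (I -> T -> T))%type.

Definition cone (h : I -> stage) (j : I) (v : stage) :=
  [/\ fact_mor v.1, forall i, lt i j -> fact_mor (v.2 i),
      forall i x, lt i j -> v.2 i ((h i).1 x) = v.1 x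
    & forall i k x, lt i k -> lt k j -> v.2 k ((h k).2 i x) = v.2 i x].

(** A chain in which every stage is a cone over the earlier ones followed by an
    endomorphism chosen for its bad behaviour on that cone. *)
Lemma exists_chain (bad : (T -> T) -> (T -> T) -> Prop) :
  (forall b, fact_mor b -> exists2 u, fact_mor u & bad b u) ->
  exists h : I -> stage, forall j, cone h j (h j) /\
    exists v u, [/\ cone h j v, fact_mor u, bad v.1 u &
      h j = (u \o v.1, fun i => u \o v.2 i)].
Proof.
move=> ex_bad.
pose step (j : I) (h : I -> stage) (w : stage) := exists v u,
  [/\ cone h j v, fact_mor u, bad v.1 u & w = (u \o v.1, fun i => u \o v.2 i)].
pose pick j h : stage :=
  if pselect (exists w, step j h w) is left e then sval (cid e) else (id, fun=> id).
pose ext j (rec : forall i, lt i j -> stage) : I -> stage :=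
  fun i => if pselect (lt i j) is left e then rec i e else (id, fun=> id).
pose h := Fix lt_wf (fun=> stage) (fun j rec => pick j (ext j rec)).
have cone_eq j g g' v : (forall i, lt i j -> g i = g' i) -> cone g j v -> cone g' j v.
  move=> gg' [v1 v2 vc vc']; split=> // [i x ij|i k x ik kj]; first by rewrite -gg' ?vc.
  by rewrite -gg' ?vc'.
have hE j : h j = pick j (ext j (fun i _ => h i)).
  rewrite /h Fix_eq // => k f g fg; congr (pick _ _); apply/funext => i; rewrite /ext.
  by case: pselect.
have ext_h j i : lt i j -> ext j (fun i _ => h i) i = h i.
  by rewrite /ext; case: pselect.
suff ok j : cone h j (h j) /\ step j h (h j) by exists h => j; have [? ?] := ok j.
elim/(well_founded_ind lt_wf): j => j IH.
(* The stages below [j] together with a bottom, the index [None], form a chain. *)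
have [w wP] : exists w, step j h w.
  pose J := option {i | lt i j}.
  pose le (a b : J) := match a, b with None, _ => True | Some _, None => False
    | Some i, Some k => sval i = sval k \/ lt (sval i) (sval k) end.
  pose d (a b : J) : T -> T := match a, b with
    | Some i, Some k => if pselect (sval i = sval k) then id else (h (sval k)).2 (sval i)
    | None, Some k => (h (sval k)).1
    | _, None => id end.
  have irr := well_founded_irreflexive lt_wf.
  have [|||||c [cm cc]] := @chain_cone J le d.
  - by case=> [i|] //=; left.
  - move=> [i|] [k|] [l|] //= [->|ik] [kl|kl]; rewrite -?kl; [by left|by right|by right|].
    by right; exact: lt_trans ik kl.
  - by move=> [i|] [k|] /=; (try by left); (try by right); case: (lt_total (sval i) (sval k));
      [left; left|left; right|right; right].
  - move=> [i|] [k|] //= ik; last by have [[]] := IH _ (svalP k).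
    case: pselect => // nik; case: ik => // ik.
    by have [[_ h2 _ _] _] := IH _ (svalP k); exact: h2.
  - move=> [[i ij]|] [[k kj]|] [[l lj]|] x //= ik kl; last 1 first.
      case: pselect => [e|nkl]; first by rewrite /= e.
      by case: kl => // kl; have [[_ _ vc _] _] := IH _ lj; exact: vc.
    case: (pselect (i = k)) => [e|nik]; first by subst k.
    have {}ik : lt i k by case: ik.
    case: (pselect (k = l)) => [e|nkl]; first by subst l; case: pselect.
    have {}kl : lt k l by case: kl.
    case: (pselect (i = l)) => [il|nil].
      by case: (irr i); rewrite {2}il; exact: lt_trans ik kl.
    by have [[_ _ _ vc] _] := IH _ lj; exact: vc.
  pose v : stage := (c None,
    fun i => if pselect (lt i j) is left e then c (Some (exist _ i e)) else id).
  have vE i (e : lt i j) : v.2 i = c (Some (exist _ i e)).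
    by rewrite /v /=; case: pselect => // e'; rewrite (Prop_irrelevance e e').
  have cv : cone h j v.
    split=> [|i ij|i x ij|i k x ik kj].
    - exact: cm.
    - by rewrite (vE _ ij).
    - by rewrite (vE _ ij); exact: (cc None (Some (exist _ i ij))).
    - have ij := lt_trans ik kj; rewrite (vE k kj) (vE i ij).
      rewrite -(cc (Some (exist _ i ij)) (Some (exist _ k kj))) /=; last by right.
      by case: pselect => // ek; case: (irr i); rewrite {2}ek.
  have [u um ubad] := ex_bad v.1 (cm None).
  by exists (u \o v.1, fun i => u \o v.2 i), v, u.
have step_eq g g' w' : (forall i, lt i j -> g i = g' i) -> step j g w' -> step j g' w'.
  by move=> gg' [v [u [cv um ub wE]]]; exists v, u; split=> //; exact: cone_eq cv.
have : step j h (h j).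
  rewrite hE /pick; case: pselect => [e|[]].
    by apply: step_eq (svalP (cid e)) => i /ext_h.
  by exists w; apply: step_eq wP => i /ext_h.
move=> st; split=> //; case: st => v [u [[v1 v2 vc vc'] um _ ->]]; split=> /=.
- exact: fact_mor_comp v1 um.
- by move=> i ij; exact: fact_mor_comp (v2 i ij) um.
- by move=> i x ij; rewrite vc.
- by move=> i k x ik kj; rewrite vc'.
Qed.

Lemma chain_top (h : I -> stage) : (forall j, cone h j (h j)) ->
  exists c : I -> T -> T, (forall j, fact_mor (c j)) /\
    forall i j x, lt i j -> c j ((h j).2 i x) = c i x.
Proof.
move=> hc.
have irr := well_founded_irreflexive lt_wf.
pose le i j := i = j \/ lt i j.
pose d i j : T -> T := if pselect (i = j) then id else (h j).2 i.
have [|||||c [cm cc]] := @chain_cone I le d.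
- by left.
- by move=> i j k [->|ij] [<-|jk]; [left|right|right|right; exact: lt_trans ij jk].
- by move=> i j; case: (lt_total i j); [left; left|left; right|right; right].
- move=> i j ij; rewrite /d; case: pselect => // nij; case: ij => // ij.
  by have [_ h2 _ _] := hc j; exact: h2.
- move=> i j k x ij jk; rewrite /d.
  case: (pselect (i = j)) => [e|nij]; first by subst j.
  have {}ij : lt i j by case: ij.
  case: (pselect (j = k)) => [e|njk]; first by subst k; case: pselect.
  have {}jk : lt j k by case: jk.
  case: (pselect (i = k)) => [e|ne].
    by case: (irr i); rewrite {2}e; exact: lt_trans ij jk.
  by have [_ _ _ vc] := hc k; exact: vc.
exists c; split=> // i j x ij; rewrite -(cc i j x) /d; last by right.
by case: pselect => // e; case: (irr i); rewrite {2}e.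
Qed.

End Chains.

(** Otherwise every endomorphism could be followed by one that enlarges its
    kernel, and a chain longer than the set of relations on [T] would give a
    strictly increasing family of kernels. *)
Lemma kernel_maximal (T : factorization) : weakly_terminal T -> exists2 f : T -> T, fact_mor f &
  forall g : T -> T, fact_mor g -> forall x y, g (f x) = g (f y) -> f x = f y.
Proof.
move=> T_term; apply: contrapT => nf.
pose bad (b u : T -> T) := exists x y, u (b x) = u (b y) /\ b x <> b y.
have ex_bad b : fact_mor b -> exists2 u, fact_mor u & bad b u.
  move=> bm; apply: contrapT => nu; apply: nf; exists b => // g gm x y gxy.
  by apply: contrapT => nxy; apply: nu; exists g => //; exists x, y.
have [lt [wf trans total]] := exists_well_order ((T * T -> Prop) -> Prop).
have [h hP] := exists_chain T_term wf trans total ex_bad.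
apply: (@cantor (T * T -> Prop) (fun j xy => (h j).1 xy.1 = (h j).1 xy.2)).
have neq i j : lt i j ->
    (fun xy => (h i).1 xy.1 = (h i).1 xy.2) <> (fun xy => (h j).1 xy.1 = (h j).1 xy.2).
  move=> ij e; have [_ [v [u [[_ _ vc _] _ [x [y [uxy nxy]]] hE]]]] := hP j.
  apply: nxy; rewrite -!(vc i) //; congr (v.2 i _).
  by have := congr1 (fun k => k (x, y)) e; rewrite /= hE /= => ->.
by move=> i j e; case: (total i j) => // /neq; rewrite e.
Qed.

(** With [f] from [kernel_maximal], let [C] be the colimit of the sequence of
    copies of [T] with transition map [f]. Two elements of [C] identified by some
    morphism to [T] come from a common stage, are identified by [f] at the next
    one, and so are equal. *)
Lemma exists_mono_terminal : exists2 C : factorization, weakly_terminal C &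
  forall g : C -> C, fact_mor g -> injective g.
Proof.
have [T T_term] := exists_weakly_terminal F_dsum F_pure theta.
have [f fm fP] := kernel_maximal T_term.
have itm n : fact_mor (iter n f)
  by elim: n => [|n IH]; [exact: fact_mor_id|exact: fact_mor_comp IH fm].
have [|i j k|i j|i j _|i j k x ij jk|C [c [cm cc c_surj]]] :=
    @fact_colimit nat (fun i j => (i <= j)%N) 0%N (fun=> T) (fun i j => iter (j - i) f).
- by move=> j; exact: leqnn.
- exact: leq_trans.
- by apply/orP; exact: leq_total.
- exact: itm.
- by rewrite -iterD addnBA // subnK.
have C_mono (g : C -> T) : fact_mor g -> injective g.
  move=> gm x y; have [i [x' <-]] := c_surj x; have [j [y' <-]] := c_surj y.
  rewrite -(cc i (maxn i j) x') ?leq_maxl // -(cc j (maxn i j) y') ?leq_maxr //.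
  set k := maxn i j; set x1 := iter _ f x'; set y1 := iter _ f y'.
  rewrite -(cc k k.+1 x1) // -(cc k k.+1 y1) // subSnn /= => /(fP (g \o c k.+1)) -> //.
  exact: fact_mor_comp (cm _) gm.
exists C => [X|g gm].
  by have [a am] := T_term X; exists (c 0%N \o a); exact: fact_mor_comp am (cm _).
have [a am] := T_term C; apply: (@inj_compr _ _ _ a); apply: C_mono.
exact: fact_mor_comp gm am.
Qed.

(** If [u] is injective but not surjective, then a long chain whose successive
    maps end with [u] has a cone of injective maps with strictly increasing
    images, more of them than [T] has subsets. *)
Lemma exists_minimal_terminal : exists2 T : factorization, weakly_terminal T &
  forall g : T -> T, fact_mor g -> bijective g.
Proof.
have [T T_term T_mono] := exists_mono_terminal; exists T => // u um.
suff surj y : exists x, u x = y.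
  by have /choice[v vK] := surj; exists v => // x; apply: (T_mono u um); rewrite vK.
apply: contrapT => ny.
pose bad (b u : T -> T) := exists y, forall x, u x <> y.
have ex_bad b : fact_mor b -> exists2 u, fact_mor u & bad b u.
  by move=> _; exists u => //; exists y => x uxy; apply: ny; exists x.
have [lt [wf trans total]] := exists_well_order ((T -> Prop) -> Prop).
have [h hP] := exists_chain T_term wf trans total ex_bad.
have [|c [cm cc]] := chain_top T_term wf trans total (h := h).
  by move=> j; case: (hP j).
apply: (@cantor (T -> Prop) (fun j y => exists x, c j x = y)).
have neq i j : lt i j -> (fun y => exists x, c i x = y) <> (fun y => exists x, c j x = y).
  move=> ij e; have [_ [v [w [_ _ [z nz] hE]]]] := hP j.
  have [x cx] : exists x, c i x = c j z by rewrite (congr1 (fun k => k (c j z)) e); exists z.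
  apply: (nz (v.2 i x)); apply: (T_mono _ (cm j)).
  by rewrite -cx -(cc i j x ij) hE.
by move=> i j e; case: (total i j) => // /neq; rewrite e.
Qed.
End MinimalObject.

(** * The group [Ext1] and short exact sequences *)
Section Ext.
Variable R : pzRingType.

(** [Y] is the quotient of [X * res0 B] given by a lift [lam] of the augmentation;
    the cocycle [phi \o f] being a coboundary, [phi] and [g] agree on the relations. *)
Lemma ext_extend (X Y B N : lmodType R) (i : {linear X -> Y}) (q : {linear Y -> B})
    (phi : {linear X -> N}) : short_exact i q -> (forall e : Ext1 B N, e = 0) ->
  exists psi : {linear Y -> N}, forall x, psi (i x) = phi x.
Proof.
move=> [inj_i mid surj] /Ext1_eq0P ext0.
have [l lE] := choice surj.
pose lam : {linear res0 B -> Y} := freelift l.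
have lamE z : q (lam z) = res_aug B z.
  move: z; apply: (freemod_eq (f := q \o lam)) => b.
  by rewrite /= [lam _]freelift_delta lE [RHS]freelift_delta.
have [f fE] : exists f : {linear res1 B -> X}, forall w, i (f w) = lam (res_d1 B w).
  apply: (factor_inj (f := lam \o res_d1 B)) => // w.
  by apply/mid; rewrite lamE; apply/syz_mapP; exists w.
have [g gE] : exists g : {linear res0 B -> N}, forall w, phi (f w) = g (res_d1 B w).
  apply: (ext0 (phi \o f)) => v.
  have d0 : res_d1 B (res_d2 B v) = 0 by apply/syz_mapP; exists v.
  suff fv0 : f (res_d2 B v) = 0 by rewrite /= fv0 linear0.
  by apply: inj_i; rewrite fE d0 !linear0.
pose p (c : (X * res0 B)%type) := i c.1 + lam c.2.
have [P PE] : exists P : {linear (X * res0 B)%type -> Y}, forall c, P c = p c.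
  by apply: lin_of => a c c'; rewrite /p /= !linearP scalerDr addrACA.
have [h hE] : exists h : {linear (X * res0 B)%type -> N}, forall c, h c = phi c.1 + g c.2.
  by apply: lin_of => a c c'; rewrite /= !linearP scalerDr addrACA.
have [||psi psiE] := @factor_surj _ _ _ _ P h.
- move=> y; have [z zE] := res_aug_surj (q y).
  have /mid[x xE] : q (y - lam z) = 0 by rewrite linearB lamE zE subrr.
  by exists (x, z); rewrite PE /p xE subrK.
- move=> [x z]; rewrite PE hE /p /= => xz.
  have /syz_mapP[w wE] : res_aug B z = 0.
    by rewrite -lamE -[RHS](linear0 q) -xz linearD (mid (i x)).2 ?add0r //; exists x.
  have -> : x = - f w.
    apply: inj_i; rewrite linearN fE; apply/eqP; rewrite -addr_eq0.
    by rewrite /res_d1 wE; apply/eqP.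
  by rewrite linearN gE /res_d1 wE addNr.
exists psi => x; have := psiE (x, 0); rewrite PE hE /p /= !linear0 !addr0.
by [].
Qed.

(** A cocycle [f] defines an extension [H] of [B] by [G], the pushout along [f] of
    the resolution; a retraction of [H] onto [G] exhibits [f] as a coboundary. *)
Lemma ext_of_retracts (B G : lmodType R) :
  (forall (H : lmodType R) (j : {linear G -> H}) (p : {linear H -> B}), short_exact j p ->
     exists r : {linear H -> G}, forall x, r (j x) = x) ->
  forall e : Ext1 B G, e = 0.
Proof.
move=> retr; apply/Ext1_eq0P => f f0.
pose W := (G * res0 B)%type.
have [m mE] : exists m : {linear res1 B -> W}, forall w, m w = (f w, - res_d1 B w).
  apply: lin_of => a w w'; rewrite (linearP f) (linearP (res_d1 B)) opprD -scalerN.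
  by [].
have [K KE] := range_submod m; have [H [p [p_surj pE]]] := quotient K.
have [j jE] : exists j : {linear G -> H}, forall x, j x = p (x, 0).
  apply: lin_of => a x y; rewrite -linearP; congr (p (_, _)).
  by rewrite /= scaler0 addr0.
have [s sE] : exists s : {linear W -> B}, forall c, s c = res_aug B c.2.
  by apply: lin_of => a x y; rewrite /= linearP.
have [q qE] : exists q : {linear H -> B}, forall c, q (p c) = res_aug B c.2.
  have [c /pE/KE[w <-]|q qE] := factor_surj (f := s) p_surj.
    rewrite sE mE /= linearN (_ : res_aug B _ = 0) ?oppr0 //.
    by apply/syz_mapP; exists w.
  by exists q => c; rewrite qE sE.
have ex : short_exact j q.
  split=> [|y|b].
  - apply: raddf_inj => x /=; rewrite jE => /pE/KE[w]; rewrite mE => wx.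
    have d0 : res_d1 B w = 0.
      by rewrite -[LHS]opprK -[- res_d1 B w]/((f w, - res_d1 B w).2) wx oppr0.
    have [v vw] : exists v, res_d2 B v = w by apply/syz_mapP.
    by rewrite -[x]/((x, 0 : res0 B).1) -wx /= -vw f0.
  - split=> [|[x <-]]; last by rewrite jE qE linear0.
    have [[x z] <-] := p_surj y; rewrite qE /= => /syz_mapP[w wE].
    exists (x + f w); rewrite jE; apply/ker_eq/pE/KE; exists w; rewrite mE.
    congr (_, _) => /=; first by rewrite addrC addKr.
    by rewrite sub0r -wE.
  - by have [z <-] := res_aug_surj b; exists (p (0, z)); rewrite qE.
have [r rj] := retr H j q ex.
have [g gE] : exists g : {linear res0 B -> G}, forall z, g z = r (p (0, z)).
  apply: lin_of => a x y; rewrite -!linearP; congr (r (p (_, _))).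
  by rewrite /= scaler0 addr0.
exists g => w; rewrite gE -[LHS]rj jE; congr (r _); apply/ker_eq/pE/KE.
by exists w; rewrite mE; congr (_, _) => /=; rewrite ?subr0 ?sub0r.
Qed.

End Ext.

(** * Covers, envelopes and the cotorsion pair *)
Section Conclusion.
Variables (R : pzRingType) (F : lmodType R -> Prop).
Hypotheses (F_R : F (R^o : lmodType R)) (F_ext : closed_extension F)
  (F_dsum : closed_dsum F) (F_pure : closed_pure_quotient F).

Lemma F_zero : F (zeromod R).
Proof. by apply: F_dsum => -[]. Qed.

Lemma F_free (X : choiceType) : F (freemod R X).
Proof. exact: (F_dsum (M := fun _ : X => (R^o : lmodType R))). Qed.

Lemma exists_cover : covering F.
Proof.
move=> M.
pose theta : {linear zeromod R -> M} := \0.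
have [T T_term T_min] := exists_minimal_terminal F_dsum F_pure theta.
exists T, (fact_out T); split=> [|h hE]; last first.
  apply: T_min; split=> [|n|x]; [exact: linearP| |exact: hE].
  by rewrite (zeromod0 n) !linear0.
split; first exact: F_ext (fact_exact T) F_zero (fact_F T).
move=> Y psi FY.
have ex : short_exact (\0 : {linear zeromod R -> Y}) (idfun : {linear Y -> Y}).
  split=> [x y _|y|y]; first by rewrite (zeromod0 x) (zeromod0 y).
    by split=> [/= ->|[x <-] //]; exists 0.
  by exists y.
have comm n : psi ((\0 : {linear zeromod R -> Y}) n) = theta n by rewrite linear0.
have [f [/lin_of[g gE] _ fo]] := T_term (Factorization ex FY comm).
by exists g => y; rewrite gE fo.
Qed.

(** For the minimal weakly terminal [N -> T]: if [H] is an extension of a module of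
    [F] by [T], then [H / N] lies in [F] because [F] is closed under extensions,
    so there is a map [H -> T] under [N]. It restricts to an automorphism of [T],
    and the extension splits. *)
Lemma exists_special_envelope (N : lmodType R) :
  exists (G A : lmodType R) (i : {linear N -> G}) (q : {linear G -> A}),
    [/\ short_exact i q, F A, rperp F G & envelope (rperp F) i].
Proof.
pose theta : {linear N -> zeromod R} := \0.
have [T T_term T_min] := exists_minimal_terminal F_dsum F_pure theta.
have [inj_i mid surj] := fact_exact T.
have perpT : rperp F T.
  move=> B FB; apply: ext_of_retracts => H j p [inj_j mid_j surj_j].
  pose i' : {linear N -> H} := j \o fact_in T.
  have [I IE] := range_submod i'; have [C [c [c_surj cE]]] := quotient I.
  have ci n : c (j (fact_in T n)) = 0 by apply/cE/IE; exists n.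
  have ex : short_exact i' c.
    split=> [|y|//]; first exact: inj_comp inj_j inj_i.
    by rewrite cE IE.
  have FC : F C.
    have [u uE] : exists u : {linear fact_coker T -> C}, forall x, u (fact_proj T x) = c (j x).
      by apply: (factor_surj (f := c \o j)) => // x /mid[n <-]; exact: ci.
    have [v vE] : exists v : {linear C -> B}, forall y, v (c y) = p y.
      apply: factor_surj => // y /cE/IE[n <-]; apply/mid_j.
      by exists (fact_in T n).
    apply: (F_ext (i := u) (p := v)) (fact_F T) FB; split=> [|y|b].
    - apply: raddf_inj => a /=; have [x <-] := surj a; rewrite uE => /cE/IE[n nx].
      by apply/mid; exists n; apply: inj_j.
    - have [z <-] := c_surj y; rewrite vE; split=> [/mid_j[x <-]|[a]].
        by exists (fact_proj T x).
      have [x <-] := surj a; rewrite uE -vE => <-.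
      by rewrite vE; apply/mid_j; exists x.
    - by have [y <-] := surj_j b; exists (c y).
  have comm n : (\0 : {linear H -> zeromod R}) (i' n) = theta n by [].
  have [f fm] := T_term (Factorization ex FC comm); have [/lin_of[r rE] ri _] := fm.
  pose e : {linear T -> T} := r \o j.
  have [e' e'K eK'] : bijective e.
    apply: T_min; split=> [|n|x]; first exact: linearP.
      by rewrite /e /= rE; exact: ri.
    rewrite (zeromod0 (fact_out T _)); apply/esym; exact: zeromod0.
  have [k kE] : exists k : {linear T -> T}, forall x, k x = e' x.
    by apply: lin_of; apply: can2_linear e'K eK'.
  by exists (k \o r) => x /=; rewrite kE; exact: e'K.
exists T, (fact_coker T), (fact_in T), (fact_proj T).
split; [exact: fact_exact|exact: fact_F|exact: perpT|].
split=> [|h hE]; last first.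
  apply: T_min; split=> [|//|x]; first exact: linearP.
  by rewrite (zeromod0 (fact_out T _)); apply/esym; exact: zeromod0.
split=> // Y psi perpY; apply: ext_extend (fact_exact T) _.
exact: perpY (fact_F T).
Qed.

(** Let [K] be the kernel of a free module [P -> M], and [K -> G] a special envelope
    with cokernel [A]. Since [Ext1 M G = 0], the embedding [K -> G] extends to
    [psi : P -> G], and [P -> G * M -> A] is exact; so [G * M] is in [F], and its
    pure quotient [M] as well. *)
Lemma lperp_rperp M : lperp (rperp F) M -> F M.
Proof.
move=> perpM.
have [I IE] := ker_submod (res_aug M); have [K [k [inj_k kE]]] := submod_inclusion I.
have [G [A [i [q [[inj_i mid surj] FA perpG _]]]]] := exists_special_envelope K.
have exP : short_exact k (res_aug M).
  split=> // [x|m]; last exact: res_aug_surj.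
  by rewrite -IE kE.
have [psi psiE] := ext_extend i exP (perpM G perpG).
pose W : lmodType R := (G * M)%type.
have [u uE] : exists u : {linear res0 M -> W}, forall x, u x = (psi x, res_aug M x).
  by apply: lin_of => a x y; rewrite !linearP.
have [s sE] : exists s : {linear (G * res0 M)%type -> W}, forall c, s c = (c.1, res_aug M c.2).
  by apply: lin_of => a x y; rewrite /= linearP.
have [t tE] : exists t : {linear (G * res0 M)%type -> A}, forall c, t c = q (c.1 - psi c.2).
  apply: lin_of => a x y; rewrite -linearP; congr (q _).
  by rewrite /= linearP opprD addrACA -scalerBr.
have [y|c|v vE] := factor_surj (p := s) (f := t).
- by have [x xE] := res_aug_surj y.2; exists (y.1, x); rewrite sE xE; case: y {xE}.
- rewrite sE tE => -[c1 /IE/kE[x xE]]; rewrite c1 -xE psiE sub0r -linearN.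
  by apply/mid; exists (- x); rewrite linearN.
have {}vE g x : v (g, res_aug M x) = q (g - psi x).
  by have := vE (g, x); rewrite sE tE.
have FW : F W.
  apply: (F_ext (i := u) (p := v)) (F_free _) FA; split=> [|[g m]|a].
  - apply: raddf_inj => x /=; rewrite uE => -[psi0 /IE/kE[y yE]].
    by move: psi0; rewrite -yE psiE => i0; rewrite (inj_i y 0) ?linear0.
  - have [x <-] := res_aug_surj m; rewrite vE; split=> [/mid[y yE]|[z]].
      have ky0 : res_aug M (k y) = 0 by apply/IE/kE; exists y.
      by exists (x + k y); rewrite uE !linearD /= psiE yE ky0 addr0 addrC subrK.
    rewrite uE => zgx; have <- : psi z = g := congr1 fst zgx.
    have zx : res_aug M z = res_aug M x := congr1 snd zgx.
    have /IE/kE[y yE] : res_aug M (z - x) = 0 by rewrite linearB zx subrr.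
    by rewrite -linearB -yE psiE; apply/mid; exists y.
  - by have [g <-] := surj a; exists (g, 0); rewrite -(linear0 (res_aug M)) vE linear0 subr0.
have [p pE] : exists p : {linear W -> M}, forall c, p c = c.2 by apply: lin_of.
have [r rE] : exists r : {linear M -> W}, forall m, r m = (0, m).
  by apply: lin_of => a x y; congr (_, _); rewrite /= scaler0 addr0.
by apply: (split_quotient F_pure (p := p) (s := r)) FW => m; rewrite pE rE.
Qed.

End Conclusion.

Theorem theorem3p4 (R : pzRingType) (F : lmodType R -> Prop) :
  closed_iso F ->
  F (R^o : lmodType R) ->
  closed_extension F ->
  closed_dsum F ->
  closed_pure_sub F ->
  closed_pure_quotient F ->
  perfect_cotorsion_pair F (rperp F) /\ covering F /\ enveloping (rperp F).
Proof.
move=> _ F_R F_ext F_dsum _ F_pure.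
have cov : covering F by exact: exists_cover.
have env : enveloping (rperp F).
  move=> N; have [G [A [i [q [_ _ _ ?]]]]] := exists_special_envelope F_ext F_dsum F_pure N.
  by exists G, i.
split=> //; split=> //; split=> // M; split=> [FM N|]; first exact.
exact: lperp_rperp.
Qed.
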